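(* Let $\mathcal X,\mathcal Y$ be nonempty convex compact sets and $\mathcal L:\mathcal X\times\mathcal Y\to\mathbb R$ a differentiable, uniformly strongly convex-concave function with saddle point $(x^*,y^* )$ and finite curvature constant $C_{\mathcal L}$. Consider one of two cases: (I) $(x^*,y^* )$ lies in the relative interior of $\mathcal X\times\mathcal Y$, $\mu_{\mathcal L}^{int}>0$, and we set $(g_t,\nu,\mu_{\mathcal L}):=(g_t^{FW},\nu^{FW},\mu_{\mathcal L}^{int})$ with $\nu^{FW}:=1-\frac{M_{\mathcal L}}{\sqrt{\mu^{int}_{\mathcal L}}}$, the algorithm being SP-FW; or (P) $\mathcal X=\mathrm{conv}(\mathcal A)$, $\mathcal Y=\mathrm{conv}(\mathcal B)$ with $\mathcal A,\mathcal B$ finite, $\mu^A_{\mathcal L}>0$, and we set $(g_t,\nu,\mu_{\mathcal L}):=(g_t^{PFW},\nu^{PFW},\mu^A_{\mathcal L})$ with $\nu^{PFW}:=\frac12-\frac{M_{\mathcal L}}{\sqrt{\mu^A_{\mathcal L}}}$, the algorithm being SP-AFW. If $\nu>0$, then the iterates $z^{(t)}$ of the algorithm with step size $\gamma_t=\min(\gamma_{\max},\frac{\nu}{2C_{\mathcal L}}g_t)$ satisfy $$h(z^{(t)})\le P_{\mathcal L}\sqrt{2w_0}\,(1-\rho_{\mathcal L})^{k(t)/2},\qquad \rho_{\mathcal L}:=\frac{\nu^2\mu_{\mathcal L}}{2C_{\mathcal L}},$$ where $w_0:=w(z^{(0)})$ and $k(t)$ is the number of non-drop steps after $t$ steps;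 for SP-FW $k(t)=t$ and for SP-AFW $k(t)\ge t/3$. Moreover, for all $T\in\mathbb N$, $$\min_{t\le T}g_t\le\frac{2\max\{\sqrt{C_{\mathcal L}},\sqrt{w_0}(1-\rho_{\mathcal L})^{k(T)/2}\}}{\nu}\sqrt{w_0}(1-\rho_{\mathcal L})^{k(T)/2}.$$
   Context: Notation: norms $\|\cdot\|_{\mathcal X},\|\cdot\|_{\mathcal Y}$ with duals $\|\cdot\|_{\mathcal X^*},\|\cdot\|_{\mathcal Y^*}$ (Euclidean norms when pyramidal widths are involved). Convex-concave: $\mathcal L(\cdot,y)$ convex, $\mathcal L(x,\cdot)$ concave. Uniformly strongly convex-concave: there are $\mu_{\mathcal X},\mu_{\mathcal Y}>0$ with $\mathcal L(\cdot,y)$ $\mu_{\mathcal X}$-strongly convex for every $y$ and $-\mathcal L(x,\cdot)$ $\mu_{\mathcal Y}$-strongly convex for every $x$. Saddle point: $\mathcal L(x^*,y)\le\mathcal L(x^*,y^* )\le\mathcal L(x,y^* )$ for all $x,y$; $\mathcal L^*:=\mathcal L(x^*,y^* )$. For $z=(x,y)$: $r(z):=(\nabla_x\mathcal L(z),-\nabla_y\mathcal L(z))$, $h(z):=\max_{y'}\mathcal L(x,y')-\min_{x'}\mathcal L(x',y)$, $w(z):=\mathcal L(x,y^* )-\mathcal L(x^*,y)$. Algorithms. SP-FW: from $z^{(0)}$, at iteration $t$: $r^{(t)}:=r(z^{(t)})$, $s^{(t)}\in\arg\min_{s\in\mathcal X\times\mathcal Y}\langle s,r^{(t)}\rangle$,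 $g_t^{FW}:=\langle z^{(t)}-s^{(t)},r^{(t)}\rangle$, $z^{(t+1)}:=(1-\gamma_t)z^{(t)}+\gamma_ts^{(t)}$; here $\gamma_{\max}:=1$ and all steps are non-drop. SP-AFW: iterates stored as $x^{(t)}=\sum_{v\in S_x^{(t)}}\alpha_v^{(t)}v$, $y^{(t)}=\sum_{v\in S_y^{(t)}}\alpha^{(t)}_vv$ (positive weights summing to one, active sets $S_x^{(t)}\subseteq\mathcal A,S_y^{(t)}\subseteq\mathcal B$), starting from $z^{(0)}\in\mathcal A\times\mathcal B$ with singleton active sets. At iteration $t$: $d_{FW}^{(t)}:=s^{(t)}-z^{(t)}$; $v^{(t)}=(v^{(t)}_x,v^{(t)}_y)\in\arg\max_{v\in S_x^{(t)}\times S_y^{(t)}}\langle r^{(t)},v\rangle$, $d_A^{(t)}:=z^{(t)}-v^{(t)}$; if $\langle-r^{(t)},d^{(t)}_{FW}\rangle\ge\langle-r^{(t)},d^{(t)}_A\rangle$ then $d^{(t)}:=d^{(t)}_{FW}$, $\gamma_{\max}:=1$, else $d^{(t)}:=d^{(t)}_A$, $\gamma_{\max}:=\min\{\frac{\alpha_{v_x^{(t)}}}{1-\alpha_{v_x^{(t)}}},\frac{\alpha_{v_y^{(t)}}}{1-\alpha_{v_y^{(t)}}}\}$; $g^{FW}_t:=\langle-r^{(t)},d^{(t)}_{FW}\rangle$, $g_t^{PFW}:=\langle-r^{(t)},d^{(t)}_{FW}+d^{(t)}_A\rangle$; $z^{(t+1)}:=z^{(t)}+\gamma_td^{(t)}$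 with $\gamma_t\in[0,\gamma_{\max}]$, weights of each block updated accordingly (FW step: multiply by $1-\gamma_t$, add $\gamma_t$ to the FW vertex; away step: multiply by $1+\gamma_t$, subtract $\gamma_t$ from the away vertex), active sets = atoms of positive weight. A drop step is an away step with $\gamma_t=\gamma_{\max}$. Constants. $\mathcal F:=\{\mathcal L(\cdot,y):y\in\mathcal Y\}$, $\mathcal G:=\{-\mathcal L(x,\cdot):x\in\mathcal X\}$. Curvature of convex $f$ on convex compact $\mathcal K$: $C_f:=\sup\frac2{\gamma^2}(f(x+\gamma(s-v))-f(x)-\gamma\langle s-v,\nabla f(x)\rangle)$ over $x,s,v\in\mathcal K$, $\gamma>0$ with $x+\gamma(s-v)\in\mathcal K$; $C_{\mathcal L}:=\frac12(\sup_{f\in\mathcal F}C_f+\sup_{g\in\mathcal G}C_g)$. Interior strong convexity of $f$ w.r.t. $x_c$ in the relative interior of $\mathcal K$: $\mu_f^{x_c}:=\inf\frac2{\gamma^2}(f(u)-f(x)-\langle u-x,\nabla f(x)\rangle)$ over $x\in\mathcal K\setminus\{x_c\}$, $\gamma\in(0,1]$, $u=x+\gamma(s-x)$ where $s$ is the point where the ray from $x$ through $x_c$ meets the relative boundary of $\mathcal K$; $\mu^{int}_{\mathcal L}:=\min\{\inf_{f\in\mathcal F}\mu_f^{x^*},\inf_{g\in\mathcal G}\mu_g^{y^*}\}$. Geometric strong convexity of $f$ on $\mathcal K=\mathrm{conv}(\mathcal A)$: for $x\in\mathcal K$, $\mathcal S_x$ is the family of $S\subseteq\mathcal A$ such that $x$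 is a convex combination of all elements of $S$ with positive coefficients, $v_S(x)\in\arg\max_{v\in S}\langle\nabla f(x),v\rangle$, $v_f(x)\in\arg\min\{\langle\nabla f(x),v\rangle:v=v_S(x),S\in\mathcal S_x\}$, $s_f(x)\in\arg\min_{v\in\mathcal A}\langle\nabla f(x),v\rangle$, $\gamma^A(x,x'):=\frac{\langle-\nabla f(x),x'-x\rangle}{\langle-\nabla f(x),s_f(x)-v_f(x)\rangle}$, and $\mu^A_f:=\inf_{x\in\mathcal K}\inf_{x'\in\mathcal K:\langle\nabla f(x),x'-x\rangle<0}\frac2{\gamma^A(x,x')^2}(f(x')-f(x)-\langle x'-x,\nabla f(x)\rangle)$; $\mu^A_{\mathcal L}:=\min\{\inf_{f\in\mathcal F}\mu^A_f\text{ (over }\mathcal A),\inf_{g\in\mathcal G}\mu^A_g\text{ (over }\mathcal B)\}$. Bilinearity coefficients: $M_{XY}:=\sup\langle s-v,\frac{\nabla_x\mathcal L(x,y^* )-\nabla_x\mathcal L(x,y)}{\sqrt{\mathcal L^*-\mathcal L(x^*,y)}}\rangle$ over $y\in\mathcal Y\setminus\{y^*\}$, $x,s,v\in\mathcal X$; $M_{YX}:=\sup\langle s-v,\frac{\nabla_y\mathcal L(x,y)-\nabla_y\mathcal L(x^*,y)}{\sqrt{\mathcal L(x,y^* )-\mathcal L^*}}\rangle$ over $x\in\mathcal X\setminus\{x^*\}$, $y,s,v\in\mathcal Y$; $M_{\mathcal L}:=\max\{M_{XY},M_{YX}\}$. With $\hat y(x):=\arg\max_{y}\mathcal L(x,y)$,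 $\hat x(y):=\arg\min_x\mathcal L(x,y)$: $P_{\mathcal X}:=\sup_{x\ne x^*}\frac{\langle\nabla_x\mathcal L(x,\hat y(x)),x-x^*\rangle}{\sqrt{\mathcal L(x,y^* )-\mathcal L^*}}$, $P_{\mathcal Y}:=\sup_{y\ne y^*}\frac{\langle\nabla_y\mathcal L(\hat x(y),y),y^*-y\rangle}{\sqrt{\mathcal L^*-\mathcal L(x^*,y)}}$, $P_{\mathcal L}:=\max\{P_{\mathcal X},P_{\mathcal Y}\}$. *)

(* Defs.v *)
From mathcomp Require Import all_boot all_order all_algebra.
From mathcomp Require Import all_classical all_reals all_analysis.
Set Implicit Arguments. Unset Strict Implicit. Unset Printing Implicit Defensive.
Import Order.TTheory GRing.Theory Num.Theory.
Import numFieldNormedType.Exports.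
Local Open Scope ring_scope.
Local Open Scope classical_set_scope.

Definition dotv (R : realType) (k : nat) (u v : 'rV[R]_k) : R :=
  \sum_(i < k) u 0 i * v 0 i.

Definition gradx (R : realType) (n m : nat) (L : 'rV[R]_n -> 'rV[R]_m -> R)
  (x : 'rV[R]_n) (y : 'rV[R]_m) : 'rV[R]_n :=
  \row_(i < n) derive (fun x' : 'rV[R]_n => L x' y) x (delta_mx 0 i).
Definition grady (R : realType) (n m : nat) (L : 'rV[R]_n -> 'rV[R]_m -> R)
  (x : 'rV[R]_n) (y : 'rV[R]_m) : 'rV[R]_m :=
  \row_(i < m) derive (fun y' : 'rV[R]_m => L x y') y (delta_mx 0 i).

Definition aff_hull (R : realType) (k : nat) (K : set 'rV[R]_k) : set 'rV[R]_k :=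
  [set w | exists (N : nat) (c : 'I_N -> R) (p : 'I_N -> 'rV[R]_k),
     (forall i, K (p i)) /\ \sum_(i < N) c i = 1 /\ w = \sum_(i < N) c i *: p i].
Definition rel_interior (R : realType) (k : nat) (K : set 'rV[R]_k) (z : 'rV[R]_k) : Prop :=
  K z /\ exists e : R, 0 < e /\ forall w, aff_hull K w -> `|w - z| < e -> K w.

Definition strongly_convex_on (R : realType) (k : nat) (K : set 'rV[R]_k)
  (mu : R) (f : 'rV[R]_k -> R) : Prop :=
  forall u v (t : R), K u -> K v -> 0 <= t <= 1 ->
    f ((1 - t) *: u + t *: v) <=
      (1 - t) * f u + t * f v - mu / 2 * (t * (1 - t)) * dotv (u - v) (u - v).

Definition unif_strongly_convex_concave (R : realType) (n m : nat)
  (X : set 'rV[R]_n) (Y : set 'rV[R]_m) (L : 'rV[R]_n -> 'rV[R]_m -> R) : Prop :=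
  exists muX muY : R, 0 < muX /\ 0 < muY /\
    (forall y, Y y -> strongly_convex_on X muX (fun x => L x y)) /\
    (forall x, X x -> strongly_convex_on Y muY (fun y => - L x y)).

Definition saddle_point (R : realType) (n m : nat)
  (X : set 'rV[R]_n) (Y : set 'rV[R]_m) (L : 'rV[R]_n -> 'rV[R]_m -> R)
  (xs : 'rV[R]_n) (ys : 'rV[R]_m) : Prop :=
  X xs /\ Y ys /\ forall x y, X x -> Y y -> L xs y <= L xs ys <= L x ys.

Definition curv_set_X (R : realType) (n m : nat) (X : set 'rV[R]_n) (Y : set 'rV[R]_m)
  (L : 'rV[R]_n -> 'rV[R]_m -> R) : set R :=
  [set q | exists y x s v (g : R), Y y /\ X x /\ X s /\ X v /\ 0 < g /\
     X (x + g *: (s - v)) /\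
     q = 2 / g ^+ 2 * (L (x + g *: (s - v)) y - L x y - g * dotv (s - v) (gradx L x y))].
Definition curv_set_Y (R : realType) (n m : nat) (X : set 'rV[R]_n) (Y : set 'rV[R]_m)
  (L : 'rV[R]_n -> 'rV[R]_m -> R) : set R :=
  [set q | exists x y s v (g : R), X x /\ Y y /\ Y s /\ Y v /\ 0 < g /\
     Y (y + g *: (s - v)) /\
     q = 2 / g ^+ 2 * (- L x (y + g *: (s - v)) + L x y + g * dotv (s - v) (grady L x y))].
Definition curvature (R : realType) (n m : nat) (X : set 'rV[R]_n) (Y : set 'rV[R]_m)
  (L : 'rV[R]_n -> 'rV[R]_m -> R) : R :=
  (sup (curv_set_X X Y L) + sup (curv_set_Y X Y L)) / 2.

Definition ray_exit (R : realType) (k : nat) (K : set 'rV[R]_k) (u c : 'rV[R]_k) : 'rV[R]_k :=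
  u + sup [set l : R | 0 <= l /\ K (u + l *: (c - u))] *: (c - u).
Definition muint_set_X (R : realType) (n m : nat) (X : set 'rV[R]_n) (Y : set 'rV[R]_m)
  (L : 'rV[R]_n -> 'rV[R]_m -> R) (xs : 'rV[R]_n) : set R :=
  [set q | exists y x (g : R), Y y /\ X x /\ x <> xs /\ 0 < g <= 1 /\
     let u := x + g *: (ray_exit X x xs - x) in
     q = 2 / g ^+ 2 * (L u y - L x y - dotv (u - x) (gradx L x y))].
Definition muint_set_Y (R : realType) (n m : nat) (X : set 'rV[R]_n) (Y : set 'rV[R]_m)
  (L : 'rV[R]_n -> 'rV[R]_m -> R) (ys : 'rV[R]_m) : set R :=
  [set q | exists x y (g : R), X x /\ Y y /\ y <> ys /\ 0 < g <= 1 /\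
     let u := y + g *: (ray_exit Y y ys - y) in
     q = 2 / g ^+ 2 * (- L x u + L x y + dotv (u - y) (grady L x y))].
Definition mu_int (R : realType) (n m : nat) (X : set 'rV[R]_n) (Y : set 'rV[R]_m)
  (L : 'rV[R]_n -> 'rV[R]_m -> R) (xs : 'rV[R]_n) (ys : 'rV[R]_m) : R :=
  Num.min (inf (muint_set_X X Y L xs)) (inf (muint_set_Y X Y L ys)).

Definition conv_atoms (R : realType) (k p : nat) (a : 'I_p -> 'rV[R]_k) : set 'rV[R]_k :=
  [set u | exists w : 'I_p -> R, (forall i, 0 <= w i) /\ \sum_(i < p) w i = 1 /\
     u = \sum_(i < p) w i *: a i].
Definition support_rep (R : realType) (k p : nat) (a : 'I_p -> 'rV[R]_k)
  (u : 'rV[R]_k) (S : {set 'I_p}) : Prop :=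
  exists w : 'I_p -> R, (forall i, i \in S -> 0 < w i) /\ (forall i, i \notin S -> w i = 0) /\
     \sum_(i < p) w i = 1 /\ u = \sum_(i < p) w i *: a i.
(* <-grad, s_f(u) - v_f(u)> = <grad, v_f(u)> - <grad, s_f(u)> *)
Definition pfw_den (R : realType) (k p : nat) (a : 'I_p -> 'rV[R]_k)
  (gr : 'rV[R]_k) (u : 'rV[R]_k) : R :=
  inf [set q | exists S : {set 'I_p}, support_rep a u S /\
                 q = sup [set dotv gr (a i) | i in [set i | i \in S]]]
  - inf [set dotv gr (a i) | i in [set: 'I_p]].
Definition gammaA (R : realType) (k p : nat) (a : 'I_p -> 'rV[R]_k)
  (gr : 'rV[R]_k) (u u' : 'rV[R]_k) : R :=
  dotv (- gr) (u' - u) / pfw_den a gr u.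
Definition muA_set_X (R : realType) (n m p : nat) (a : 'I_p -> 'rV[R]_n) (Y : set 'rV[R]_m)
  (L : 'rV[R]_n -> 'rV[R]_m -> R) : set R :=
  [set q | exists y x x', Y y /\ conv_atoms a x /\ conv_atoms a x' /\
     dotv (gradx L x y) (x' - x) < 0 /\
     q = 2 / (gammaA a (gradx L x y) x x') ^+ 2 *
           (L x' y - L x y - dotv (x' - x) (gradx L x y))].
Definition muA_set_Y (R : realType) (n m p : nat) (X : set 'rV[R]_n) (b : 'I_p -> 'rV[R]_m)
  (L : 'rV[R]_n -> 'rV[R]_m -> R) : set R :=
  [set q | exists x y y', X x /\ conv_atoms b y /\ conv_atoms b y' /\
     dotv (- grady L x y) (y' - y) < 0 /\
     q = 2 / (gammaA b (- grady L x y) y y') ^+ 2 *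
           (- L x y' + L x y - dotv (y' - y) (- grady L x y))].
Definition mu_A (R : realType) (n m p q : nat) (a : 'I_p -> 'rV[R]_n) (b : 'I_q -> 'rV[R]_m)
  (L : 'rV[R]_n -> 'rV[R]_m -> R) : R :=
  Num.min (inf (muA_set_X a (conv_atoms b) L)) (inf (muA_set_Y (conv_atoms a) b L)).

Definition M_set_XY (R : realType) (n m : nat) (X : set 'rV[R]_n) (Y : set 'rV[R]_m)
  (L : 'rV[R]_n -> 'rV[R]_m -> R) (xs : 'rV[R]_n) (ys : 'rV[R]_m) : set R :=
  [set q | exists y x s v, Y y /\ y <> ys /\ X x /\ X s /\ X v /\
     q = dotv (s - v) ((Num.sqrt (L xs ys - L xs y))^-1 *: (gradx L x ys - gradx L x y))].
Definition M_set_YX (R : realType) (n m : nat) (X : set 'rV[R]_n) (Y : set 'rV[R]_m)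
  (L : 'rV[R]_n -> 'rV[R]_m -> R) (xs : 'rV[R]_n) (ys : 'rV[R]_m) : set R :=
  [set q | exists x y s v, X x /\ x <> xs /\ Y y /\ Y s /\ Y v /\
     q = dotv (s - v) ((Num.sqrt (L x ys - L xs ys))^-1 *: (grady L x y - grady L xs y))].
Definition M_L (R : realType) (n m : nat) (X : set 'rV[R]_n) (Y : set 'rV[R]_m)
  (L : 'rV[R]_n -> 'rV[R]_m -> R) (xs : 'rV[R]_n) (ys : 'rV[R]_m) : R :=
  Num.max (sup (M_set_XY X Y L xs ys)) (sup (M_set_YX X Y L xs ys)).

Definition P_set_X (R : realType) (n m : nat) (X : set 'rV[R]_n) (Y : set 'rV[R]_m)
  (L : 'rV[R]_n -> 'rV[R]_m -> R) (xs : 'rV[R]_n) (ys : 'rV[R]_m) : set R :=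
  [set q | exists x yh, X x /\ x <> xs /\ Y yh /\ (forall y', Y y' -> L x y' <= L x yh) /\
     q = dotv (gradx L x yh) (x - xs) / Num.sqrt (L x ys - L xs ys)].
Definition P_set_Y (R : realType) (n m : nat) (X : set 'rV[R]_n) (Y : set 'rV[R]_m)
  (L : 'rV[R]_n -> 'rV[R]_m -> R) (xs : 'rV[R]_n) (ys : 'rV[R]_m) : set R :=
  [set q | exists y xh, Y y /\ y <> ys /\ X xh /\ (forall x', X x' -> L xh y <= L x' y) /\
     q = dotv (grady L xh y) (ys - y) / Num.sqrt (L xs ys - L xs y)].
Definition P_L (R : realType) (n m : nat) (X : set 'rV[R]_n) (Y : set 'rV[R]_m)
  (L : 'rV[R]_n -> 'rV[R]_m -> R) (xs : 'rV[R]_n) (ys : 'rV[R]_m) : R :=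
  Num.max (sup (P_set_X X Y L xs ys)) (sup (P_set_Y X Y L xs ys)).

Definition hgap (R : realType) (n m : nat) (X : set 'rV[R]_n) (Y : set 'rV[R]_m)
  (L : 'rV[R]_n -> 'rV[R]_m -> R) (x : 'rV[R]_n) (y : 'rV[R]_m) : R :=
  sup [set L x y' | y' in Y] - inf [set L x' y | x' in X].
Definition wgap (R : realType) (n m : nat) (L : 'rV[R]_n -> 'rV[R]_m -> R)
  (xs : 'rV[R]_n) (ys : 'rV[R]_m) (x : 'rV[R]_n) (y : 'rV[R]_m) : R :=
  L x ys - L xs y.

(* <(u,w), r(x,y)> with r(x,y) = (grad_x L, - grad_y L) *)
Definition rdot (R : realType) (n m : nat) (L : 'rV[R]_n -> 'rV[R]_m -> R)
  (x : 'rV[R]_n) (y : 'rV[R]_m) (u : 'rV[R]_n) (w : 'rV[R]_m) : R :=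
  dotv u (gradx L x y) - dotv w (grady L x y).

Definition gap_fw (R : realType) (n m : nat) (L : 'rV[R]_n -> 'rV[R]_m -> R)
  (x : 'rV[R]_n) (y : 'rV[R]_m) (sx : 'rV[R]_n) (sy : 'rV[R]_m) : R :=
  rdot L x y x y - rdot L x y sx sy.

Definition sp_fw_run (R : realType) (n m : nat) (X : set 'rV[R]_n) (Y : set 'rV[R]_m)
  (L : 'rV[R]_n -> 'rV[R]_m -> R) (nu C : R)
  (x : nat -> 'rV[R]_n) (y : nat -> 'rV[R]_m) (sx : nat -> 'rV[R]_n) (sy : nat -> 'rV[R]_m) : Prop :=
  X (x 0%N) /\ Y (y 0%N) /\
  forall t : nat,
    X (sx t) /\ Y (sy t) /\
    (forall x' y', X x' -> Y y' -> rdot L (x t) (y t) (sx t) (sy t) <= rdot L (x t) (y t) x' y') /\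
    let g := gap_fw L (x t) (y t) (sx t) (sy t) in
    let gam := Num.min 1 (nu / (2 * C) * g) in
    x t.+1 = (1 - gam) *: x t + gam *: sx t /\
    y t.+1 = (1 - gam) *: y t + gam *: sy t.

Definition gap_away (R : realType) (n m : nat) (L : 'rV[R]_n -> 'rV[R]_m -> R)
  (x : 'rV[R]_n) (y : 'rV[R]_m) (vx : 'rV[R]_n) (vy : 'rV[R]_m) : R :=
  rdot L x y vx vy - rdot L x y x y.

(* gamma_max of an away step; a block whose away vertex has weight 1 has
   zero away direction and imposes no constraint (alpha/(1-alpha) = +oo) *)
Definition away_gmax (R : realType) (alx aly : R) : R :=
  if alx == 1 then aly / (1 - aly)
  else if aly == 1 then alx / (1 - alx)
  else Num.min (alx / (1 - alx)) (aly / (1 - aly)).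

Definition afw_is_fw (R : realType) (n m : nat) (L : 'rV[R]_n -> 'rV[R]_m -> R)
  (x : 'rV[R]_n) (y : 'rV[R]_m) (sx : 'rV[R]_n) (sy : 'rV[R]_m)
  (vx : 'rV[R]_n) (vy : 'rV[R]_m) : bool :=
  gap_away L x y vx vy <= gap_fw L x y sx sy.

Definition gap_pfw (R : realType) (n m : nat) (L : 'rV[R]_n -> 'rV[R]_m -> R)
  (x : 'rV[R]_n) (y : 'rV[R]_m) (sx : 'rV[R]_n) (sy : 'rV[R]_m)
  (vx : 'rV[R]_n) (vy : 'rV[R]_m) : R :=
  gap_fw L x y sx sy + gap_away L x y vx vy.

Definition afw_gamma (R : realType) (n m : nat) (L : 'rV[R]_n -> 'rV[R]_m -> R) (nu C : R)
  (x : 'rV[R]_n) (y : 'rV[R]_m) (sx : 'rV[R]_n) (sy : 'rV[R]_m)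
  (vx : 'rV[R]_n) (vy : 'rV[R]_m) (alx aly : R) : R :=
  let gP := gap_pfw L x y sx sy vx vy in
  if afw_is_fw L x y sx sy vx vy then Num.min 1 (nu / (2 * C) * gP)
  else Num.min (away_gmax alx aly) (nu / (2 * C) * gP).

Definition afw_drop (R : realType) (n m : nat) (L : 'rV[R]_n -> 'rV[R]_m -> R) (nu C : R)
  (x : 'rV[R]_n) (y : 'rV[R]_m) (sx : 'rV[R]_n) (sy : 'rV[R]_m)
  (vx : 'rV[R]_n) (vy : 'rV[R]_m) (alx aly : R) : bool :=
  ~~ afw_is_fw L x y sx sy vx vy &&
  (afw_gamma L nu C x y sx sy vx vy alx aly == away_gmax alx aly).

(* An SP-AFW run: iterates x y, weights ax ay on the atoms, FW vertices fx fy
   and away vertices vx vy (indices of atoms). *)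
Definition sp_afw_run (R : realType) (n m p q : nat) (a : 'I_p -> 'rV[R]_n) (b : 'I_q -> 'rV[R]_m)
  (L : 'rV[R]_n -> 'rV[R]_m -> R) (nu C : R)
  (x : nat -> 'rV[R]_n) (y : nat -> 'rV[R]_m)
  (ax : nat -> 'I_p -> R) (ay : nat -> 'I_q -> R)
  (fx vx : nat -> 'I_p) (fy vy : nat -> 'I_q) : Prop :=
  (exists (i0 : 'I_p) (j0 : 'I_q), x 0%N = a i0 /\ y 0%N = b j0 /\
     (forall i, ax 0%N i = if i == i0 then 1 else 0) /\
     (forall j, ay 0%N j = if j == j0 then 1 else 0)) /\
  forall t : nat,
    let X := conv_atoms a in let Y := conv_atoms b in
    (forall x' y', X x' -> Y y' ->
       rdot L (x t) (y t) (a (fx t)) (b (fy t)) <= rdot L (x t) (y t) x' y') /\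
    0 < ax t (vx t) /\ 0 < ay t (vy t) /\
    (forall i j, 0 < ax t i -> 0 < ay t j ->
       rdot L (x t) (y t) (a i) (b j) <= rdot L (x t) (y t) (a (vx t)) (b (vy t))) /\
    let sx := a (fx t) in let sy := b (fy t) in
    let wx := a (vx t) in let wy := b (vy t) in
    let gam := afw_gamma L nu C (x t) (y t) sx sy wx wy (ax t (vx t)) (ay t (vy t)) in
    if afw_is_fw L (x t) (y t) sx sy wx wy then
      x t.+1 = x t + gam *: (sx - x t) /\ y t.+1 = y t + gam *: (sy - y t) /\
      (forall i, ax t.+1 i = (1 - gam) * ax t i + (if i == fx t then gam else 0)) /\
      (forall j, ay t.+1 j = (1 - gam) * ay t j + (if j == fy t then gam else 0))
    else
      x t.+1 = x t + gam *: (x t - wx) /\ y t.+1 = y t + gam *: (y t - wy) /\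
      (forall i, ax t.+1 i = (1 + gam) * ax t i - (if i == vx t then gam else 0)) /\
      (forall j, ay t.+1 j = (1 + gam) * ay t j - (if j == vy t then gam else 0)).

Definition afw_nondrop (R : realType) (n m p q : nat) (a : 'I_p -> 'rV[R]_n) (b : 'I_q -> 'rV[R]_m)
  (L : 'rV[R]_n -> 'rV[R]_m -> R) (nu C : R)
  (x : nat -> 'rV[R]_n) (y : nat -> 'rV[R]_m)
  (ax : nat -> 'I_p -> R) (ay : nat -> 'I_q -> R)
  (fx vx : nat -> 'I_p) (fy vy : nat -> 'I_q) (t : nat) : nat :=
  \sum_(s < t) (if afw_drop L nu C (x s) (y s) (a (fx s)) (b (fy s)) (a (vx s)) (b (vy s))
                     (ax s (vx s)) (ay s (vy s)) then 0 else 1)%N.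

(* Main.v *)
Require Import Defs.
From mathcomp Require Import all_boot all_order all_algebra.
From mathcomp Require Import all_classical all_reals all_analysis.
From mathcomp Require Import ring lra zify.
Set Implicit Arguments. Unset Strict Implicit. Unset Printing Implicit Defensive.
Import Order.TTheory GRing.Theory Num.Theory.
Import numFieldNormedType.Exports.
Local Open Scope ring_scope.
Local Open Scope classical_set_scope.

(* Writing [w] for the merit [wgap], [g] for the gap and [d] for the step
   direction, the curvature bounds at [(x, ys)] and [(xs, y)] and the bilinearity
   coefficient give
     [w' <= w - gamma <-r, d> + gamma M sqrt (2 w) + gamma^2 C].
   Interior (or geometric) strong convexity gives [w <= g^2 / (2 mu)], so the
   error term is at most [gamma (M / sqrt mu) g] and
     [w' <= w - nu gamma g + gamma^2 C].
   With the prescribed step size a non-drop step contracts [w] by [1 - rho] (when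
   it is clipped at 1 this uses [mu <= C] and [w <= g]) and a drop step does not
   increase it; the same inequality with [0 <= w'] bounds [g] by [w].  The number
   of drop steps is controlled by the number of active atoms, which a drop step
   decreases and a non-drop step increases by at most two.  Finally [h] is bounded
   by [P sqrt (2 w)] through the gradient inequality at the best responses. *)

(** The bound of the merit by the squared gap is proved per block: one block controls
    [L x y - L xs y], the other [L x ys - L x y], and the sum telescopes to [wgap]. This works
    because a linear form over a product is optimised blockwise. The comparison [mu <= C] is not
    assumed: in each block the sets of quotients behind the two constants share an element. In
    SP-AFW the chosen direction is only guaranteed half of the pairwise gap, which is the origin of
    the 1/2 in [nu]. At step 0 this half is not lost, since singleton active sets have no away gap;
    the surplus pays for the factor that a drop step would otherwise cost in the bound on the
    smallest gap. *)

(** * Bilinearity and positivity of the dot product *)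

Lemma dotvC (R : realType) (k : nat) (u v : 'rV[R]_k) : dotv u v = dotv v u.
Proof. by apply: eq_bigr => i _; rewrite mulrC. Qed.

Lemma dotvDl (R : realType) (k : nat) (u v w : 'rV[R]_k) :
  dotv (u + v) w = dotv u w + dotv v w.
Proof. by rewrite -big_split; apply: eq_bigr => i _; rewrite !mxE mulrDl. Qed.

Lemma dotvZl (R : realType) (k : nat) (c : R) (u w : 'rV[R]_k) :
  dotv (c *: u) w = c * dotv u w.
Proof. by rewrite mulr_sumr; apply: eq_bigr => i _; rewrite !mxE mulrA. Qed.

Lemma dotvNl (R : realType) (k : nat) (u w : 'rV[R]_k) : dotv (- u) w = - dotv u w.
Proof. by rewrite -scaleN1r dotvZl mulN1r. Qed.

Lemma dotvBl (R : realType) (k : nat) (u v w : 'rV[R]_k) :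
  dotv (u - v) w = dotv u w - dotv v w.
Proof. by rewrite dotvDl dotvNl. Qed.

Lemma dot0v (R : realType) (k : nat) (w : 'rV[R]_k) : dotv 0 w = 0.
Proof. by rewrite -(scale0r 0) dotvZl mul0r. Qed.

Lemma dotvDr (R : realType) (k : nat) (w u v : 'rV[R]_k) :
  dotv w (u + v) = dotv w u + dotv w v.
Proof. by rewrite dotvC dotvDl !(dotvC w). Qed.

Lemma dotvZr (R : realType) (k : nat) (c : R) (w u : 'rV[R]_k) :
  dotv w (c *: u) = c * dotv w u.
Proof. by rewrite dotvC dotvZl dotvC. Qed.

Lemma dotvNr (R : realType) (k : nat) (w u : 'rV[R]_k) : dotv w (- u) = - dotv w u.
Proof. by rewrite dotvC dotvNl dotvC. Qed.

Lemma dotvBr (R : realType) (k : nat) (w u v : 'rV[R]_k) :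
  dotv w (u - v) = dotv w u - dotv w v.
Proof. by rewrite dotvDr dotvNr. Qed.

Lemma dotv_suml (R : realType) (k p : nat) (c : 'I_p -> R) (a : 'I_p -> 'rV[R]_k)
  (w : 'rV[R]_k) : dotv (\sum_i c i *: a i) w = \sum_i c i * dotv (a i) w.
Proof.
rewrite /dotv; under eq_bigr do rewrite summxE mulr_suml.
rewrite exchange_big; apply: eq_bigr => i _; rewrite mulr_sumr.
by apply: eq_bigr => j _; rewrite !mxE mulrA.
Qed.

Lemma dotvv_gt0 (R : realType) (k : nat) (u : 'rV[R]_k) : u != 0 -> 0 < dotv u u.
Proof.
move=> u0; have ge0 : forall i : 'I_k, true -> 0 <= u 0 i * u 0 i.
  by move=> i _; rewrite -expr2 sqr_ge0.
rewrite lt0r sumr_ge0 // andbT psumr_eq0 //; apply: contra u0 => /allP u0.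
apply/eqP/rowP => i; have := u0 i (mem_index_enum _).
by rewrite mxE implyTb -expr2 sqrf_eq0 => /eqP.
Qed.

(** * Convex sets, attained extrema and the exit point of a ray *)

Lemma convex_setE (R : realType) (k : nat) (K : set 'rV[R]_k) : convex_set K ->
  forall u v (t : R), K u -> K v -> 0 <= t <= 1 -> K ((1 - t) *: u + t *: v).
Proof.
move=> cK u v t Ku Kv /andP[t0 t1].
have := cK v u (Itv01 t0 t1); rewrite !inE => /(_ Kv Ku).
by rewrite /conv /= addrC.
Qed.

Lemma convex_set_ray (R : realType) (k : nat) (K : set 'rV[R]_k) : convex_set K ->
  forall u v (t : R), K u -> K v -> 0 <= t <= 1 -> K (u + t *: (v - u)).
Proof.
move=> cK u v t Ku Kv t01; have := @convex_setE _ _ _ cK _ _ _ Ku Kv t01.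
by congr K; rewrite scalerBl scale1r scalerBr addrAC addrA.
Qed.

(** [inf] defaults to 0 on a set that is empty or unbounded below, so positivity alone certifies a
    genuine lower bound. *)
Lemma inf_le_mem (R : realType) (A : set R) (q : R) : 0 < inf A -> A q -> inf A <= q.
Proof.
move=> A0 Aq; apply: ge_inf => //.
by apply: contrapT => nA; move: A0; rewrite inf_out ?ltxx // => -[].
Qed.

Lemma inf_gt0_nonempty (R : realType) (A : set R) : 0 < inf A -> A !=set0.
Proof.
move=> A0; apply: contrapT => nA; move: A0; rewrite inf_out ?ltxx // => -[].
by [].
Qed.

Lemma inf_image_attained (R : realType) (T : Type) (A : set T) (f : T -> R) (c : T) :
  A c -> (forall t, A t -> f c <= f t) -> inf [set f t | t in A] = f c.
Proof.
move=> Ac fc; apply/eqP; rewrite eq_le; apply/andP; split.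
  by apply: ge_inf; [exists (f c) => _ [t At <-]; exact: fc | exists c].
by apply: lb_le_inf; [exists (f c), c | move=> _ [t At <-]; exact: fc].
Qed.

Lemma sup_image_attained (R : realType) (T : Type) (A : set T) (f : T -> R) (c : T) :
  A c -> (forall t, A t -> f t <= f c) -> sup [set f t | t in A] = f c.
Proof.
move=> Ac fc; apply/eqP; rewrite eq_le; apply/andP; split.
  by apply: ge_sup; [exists (f c), c | move=> _ [t At <-]; exact: fc].
by apply: ub_le_sup; [exists (f c) => _ [t At <-]; exact: fc | exists c].
Qed.

(** The parameters that stay in the compact [K] form a closed bounded set, so the supremum in
    [ray_exit] is attained. It is at least 1, since [c] itself is reached at 1, and its inverse is
    the required [g]. *)
Lemma ray_exitP (R : realType) (k : nat) (K : set 'rV[R]_k) (u c : 'rV[R]_k) :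
  compact K -> K u -> K c -> u <> c ->
  K (ray_exit K u c) /\
  exists g : R, 0 < g <= 1 /\ c = u + g *: (ray_exit K u c - u).
Proof.
move=> cK Ku Kc uc.
have d0 : 0 < `|c - u| by rewrite normr_gt0 subr_eq0; apply/eqP => /esym.
rewrite /ray_exit; set A := [set l : R | _]; set l := sup A.
have A1 : A 1 by split=> //; rewrite scale1r addrC subrK.
have uA : has_ubound A.
  have [M [_ MK]] := compact_bounded cK.
  exists ((M + 1 + `|u|) / `|c - u|) => r [r0 Kr].
  rewrite ler_pdivlMr // -{1}(ger0_norm r0) -normrZ.
  have -> : r *: (c - u) = (u + r *: (c - u)) - u by rewrite addrAC subrr add0r.
  apply: (le_trans (ler_normB _ _)); rewrite lerD2r.
  by apply: MK => //; rewrite ltrDl.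
have l1 : 1 <= l by exact: ub_le_sup.
have Al : A l.
  have cA : closed A.
    rewrite (_ : A = [set r : R | 0 <= r] `&` (fun r : R => u + r *: (c - u)) @^-1` K) //.
    apply: closedI; first exact: closed_ge.
    apply: closed_comp; last exact: (compact_closed (@norm_hausdorff _ _)).
    move=> r _; apply: cvgD; first exact: cvg_cst.
    by apply: cvgZr_tmp; exact: cvg_id.
  by apply: cA; apply: closure_sup => //; exists 1.
have lp : 0 < l by lra.
split; first by case: Al.
exists l^-1; split; first by rewrite invr_gt0 lp invf_le1.
rewrite [X in _ *: X]addrAC subrr add0r scalerA mulVf ?gt_eqF // scale1r.
by rewrite addrC subrK.
Qed.

(** * The saddle-point problem, its symmetry and first-order convexity *)

(** Differentiability is stated in each variable separately, so that exchanging the two players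
    preserves it at once. *)
Definition scc_problem (R : realType) (n m : nat) (X : set 'rV[R]_n) (Y : set 'rV[R]_m)
  (L : 'rV[R]_n -> 'rV[R]_m -> R) (xs : 'rV[R]_n) (ys : 'rV[R]_m) : Prop :=
  [/\ convex_set X, convex_set Y,
      forall x y, X x -> Y y ->
        differentiable (fun x' => L x' y) x /\ differentiable (fun y' => L x y') y,
      unif_strongly_convex_concave X Y L & saddle_point X Y L xs ys].

(* Exchanging the two players turns every statement about the minimisation
   block into the one about the maximisation block. *)
Definition flip (R : realType) (n m : nat) (L : 'rV[R]_n -> 'rV[R]_m -> R) :
  'rV[R]_m -> 'rV[R]_n -> R := fun y x => - L x y.

Lemma differentiable_fst_arg (R : realType) (n m : nat)
  (L : 'rV[R]_n -> 'rV[R]_m -> R) (x : 'rV[R]_n) (y : 'rV[R]_m) :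
  differentiable (fun z : 'rV[R]_n * 'rV[R]_m => L z.1 z.2) (x, y) ->
  differentiable (fun x' => L x' y) x.
Proof.
move=> dL.
have dp : differentiable (fun x' : 'rV[R]_n => (x', y)) x.
  by apply: differentiable_pair.
exact: (@differentiable_comp _ _ _ _ (fun x' : 'rV[R]_n => (x', y)) _ x dp dL).
Qed.

Lemma differentiable_snd_arg (R : realType) (n m : nat)
  (L : 'rV[R]_n -> 'rV[R]_m -> R) (x : 'rV[R]_n) (y : 'rV[R]_m) :
  differentiable (fun z : 'rV[R]_n * 'rV[R]_m => L z.1 z.2) (x, y) ->
  differentiable (fun y' => L x y') y.
Proof.
move=> dL.
have dp : differentiable (fun y' : 'rV[R]_m => (x, y')) y.
  by apply: differentiable_pair.
exact: (@differentiable_comp _ _ _ _ (fun y' : 'rV[R]_m => (x, y')) _ y dp dL).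
Qed.

Lemma derive_gradx (R : realType) (n m : nat) (L : 'rV[R]_n -> 'rV[R]_m -> R)
  (x : 'rV[R]_n) (y : 'rV[R]_m) (v : 'rV[R]_n) :
  differentiable (fun x' => L x' y) x ->
  derive (fun x' => L x' y) x v = dotv v (gradx L x y).
Proof.
move=> dL; rewrite deriveE // {1}(row_sum_delta v) linear_sum.
apply: eq_bigr => i _; rewrite linearZ /= mxE deriveE //.
Qed.

Lemma gradx_flip (R : realType) (n m : nat) (X : set 'rV[R]_n) (Y : set 'rV[R]_m)
  (L : 'rV[R]_n -> 'rV[R]_m -> R) (xs : 'rV[R]_n) (ys : 'rV[R]_m) x y :
  scc_problem X Y L xs ys -> X x -> Y y -> gradx (flip L) y x = - grady L x y.
Proof.
case=> _ _ dL _ _ Xx Yy; apply/rowP => i; rewrite !mxE.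
by rewrite -deriveN //; apply: diff_derivable; exact: (dL _ _ Xx Yy).2.
Qed.

Lemma scc_flip (R : realType) (n m : nat) (X : set 'rV[R]_n) (Y : set 'rV[R]_m)
  (L : 'rV[R]_n -> 'rV[R]_m -> R) (xs : 'rV[R]_n) (ys : 'rV[R]_m) :
  scc_problem X Y L xs ys -> scc_problem Y X (flip L) ys xs.
Proof.
case=> cX cY dL [mx [my [mx0 [my0 [sx sy]]]]] [Xs [Ys sp]]; split => //.
- by move=> y x Yy Xx; have [dx dy] := dL _ _ Xx Yy; split; exact: differentiableN.
- exists my, mx; do !split => //.
  move=> y Yy u v t Xu Xv t01; rewrite /flip !opprK; exact: sx.
- do 2 split => //; move=> y x Yy Xx; rewrite /flip !lerN2.
  by have /andP[-> ->] := sp x y Xx Yy.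
Qed.

Lemma scc_strict (R : realType) (n m : nat) (X : set 'rV[R]_n) (Y : set 'rV[R]_m)
  (L : 'rV[R]_n -> 'rV[R]_m -> R) (xs : 'rV[R]_n) (ys : 'rV[R]_m) y u v (t : R) :
  scc_problem X Y L xs ys -> Y y -> X u -> X v -> 0 <= t <= 1 ->
  exists2 mu : R, 0 < mu & L (u + t *: (v - u)) y <=
    (1 - t) * L u y + t * L v y - mu * (t * (1 - t)) * dotv (u - v) (u - v).
Proof.
case=> _ _ _ [mx [_ [mx0 [_ [sx _]]]]] _ Yy Xu Xv t01.
exists (mx / 2); first by rewrite divr_gt0.
have := sx _ Yy _ _ _ Xu Xv t01; congr (L _ _ <= _).
by rewrite scalerBl scale1r scalerBr addrAC addrA.
Qed.

(** By convexity every difference quotient along [x' - x] with step in (0, 1] is at most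
    [L x' y - L x y], and the directional derivative is their limit from the right. *)
Lemma scc_gradient_ineq (R : realType) (n m : nat) (X : set 'rV[R]_n) (Y : set 'rV[R]_m)
  (L : 'rV[R]_n -> 'rV[R]_m -> R) (xs : 'rV[R]_n) (ys : 'rV[R]_m) x x' y :
  scc_problem X Y L xs ys -> X x -> X x' -> Y y ->
  L x y - L x' y <= dotv (x - x') (gradx L x y).
Proof.
move=> H Xx Xx' Yy; have [_ _ dL _ _] := H.
have [dLx _] := dL _ _ Xx Yy.
suff: dotv (x' - x) (gradx L x y) <= L x' y - L x y.
  by rewrite !dotvBl; lra.
rewrite -derive_gradx //.
have /cvg_ex[l cl] := @diff_derivable _ _ _ _ _ (x' - x) dLx.
have -> : derive (fun x0 => L x0 y) x (x' - x) = l by exact: cvg_lim.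
move/cvg_dnbhs_at_right: cl => cl.
apply: (cvgr_to_le cl); near=> h.
have h0 : 0 < h by near: h; exact: nbhs_right_gt.
have h1 : h <= 1 by near: h; exact: nbhs_right_le.
have h01 : 0 <= h <= 1 by rewrite h1 ltW.
have [mu mu0 hs] := scc_strict H Yy Xx Xx' h01.
have dp : 0 <= dotv (x - x') (x - x').
  have [->|/dotvv_gt0/ltW //] := eqVneq (x - x') 0; first by rewrite dot0v.
have : 0 <= mu * (h * (1 - h)) * dotv (x - x') (x - x').
  by rewrite mulr_ge0 // mulr_ge0 ?(ltW mu0) // mulr_ge0 ?subr_ge0 // ltW.
have -> (r : R) : h^-1 *: r = r / h by exact: mulrC.
rewrite ler_pdivrMr //= (addrC _ x).
by move: hs; set A := L (x + _) y; lra.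
Unshelve. all: by end_near. Qed.

(** Otherwise strong convexity would put the midpoint of [x] and [xs] strictly below the minimum.
    The strictness makes the square roots in the denominators of [M_L] and [P_L] positive. *)
Lemma saddle_unique (R : realType) (n m : nat) (X : set 'rV[R]_n) (Y : set 'rV[R]_m)
  (L : 'rV[R]_n -> 'rV[R]_m -> R) (xs : 'rV[R]_n) (ys : 'rV[R]_m) x :
  scc_problem X Y L xs ys -> X x -> x <> xs -> L xs ys < L x ys.
Proof.
move=> H Xx xxs; have [cX _ _ _ [Xs [Ys sp]]] := H.
have h01 : 0 <= (2^-1 : R) <= 1 by lra.
have [mu mu0 hs] := scc_strict H Ys Xx Xs h01.
have /andP[_] := sp _ _ (convex_set_ray cX Xx Xs h01) Ys.
have : 0 < mu * (2^-1 * (1 - 2^-1)) * dotv (x - xs) (x - xs).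
  rewrite mulr_gt0 //; first by rewrite mulr_gt0 //; lra.
  by rewrite dotvv_gt0 // subr_eq0; exact/eqP.
move: hs; set A := L (x + _) ys; lra.
Qed.

(** * Curvature and bilinearity as pointwise bounds *)

Lemma curvature_bound (R : realType) (n m : nat) (X : set 'rV[R]_n) (Y : set 'rV[R]_m)
  (L : 'rV[R]_n -> 'rV[R]_m -> R) x s v y (g : R) :
  has_ubound (curv_set_X X Y L) ->
  X x -> X s -> X v -> Y y -> 0 <= g -> X (x + g *: (s - v)) ->
  L (x + g *: (s - v)) y <=
    L x y + g * dotv (s - v) (gradx L x y) + g ^+ 2 / 2 * sup (curv_set_X X Y L).
Proof.
move=> ub Xx Xs Xv Yy; rewrite le_eqVlt => /orP[/eqP<- _|g0 Xu].
  by rewrite scale0r addr0 expr0n /= !mul0r !addr0.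
have /(ub_le_sup ub) : curv_set_X X Y L (2 / g ^+ 2 *
    (L (x + g *: (s - v)) y - L x y - g * dotv (s - v) (gradx L x y))).
  by exists y, x, s, v, g.
have g2 : 0 < g ^+ 2 by rewrite exprn_gt0.
rewrite mulrAC ler_pdivrMr //; lra.
Qed.

Lemma bilinearity_bound (R : realType) (n m : nat) (X : set 'rV[R]_n) (Y : set 'rV[R]_m)
  (L : 'rV[R]_n -> 'rV[R]_m -> R) (xs : 'rV[R]_n) (ys : 'rV[R]_m) x s v y :
  scc_problem X Y L xs ys -> has_ubound (M_set_XY X Y L xs ys) ->
  X x -> X s -> X v -> Y y ->
  dotv (s - v) (gradx L x ys - gradx L x y) <=
    sup (M_set_XY X Y L xs ys) * Num.sqrt (L xs ys - L xs y).
Proof.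
move=> H ub Xx Xs Xv Yy.
(* The set behind the coefficient excludes [y = ys]; there both sides vanish. *)
have [->|/eqP yys] := eqVneq y ys.
  by rewrite !subrr sqrtr0 mulr0 dotvC dot0v.
have := saddle_unique (scc_flip H) Yy yys; rewrite /flip ltrN2 -subr_gt0 => w0.
have /(ub_le_sup ub) : M_set_XY X Y L xs ys (dotv (s - v)
    ((Num.sqrt (L xs ys - L xs y))^-1 *: (gradx L x ys - gradx L x y))).
  by exists y, x, s, v.
by rewrite dotvZr mulrC ler_pdivrMr // sqrtr_gt0.
Qed.

(** Taking [s = v] puts 0 into a nonempty set, and [sup] of the empty set is 0. The sign is what
    yields [nu <= 1]. *)
Lemma M_XY_ge0 (R : realType) (n m : nat) (X : set 'rV[R]_n) (Y : set 'rV[R]_m)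
  (L : 'rV[R]_n -> 'rV[R]_m -> R) (xs : 'rV[R]_n) (ys : 'rV[R]_m) :
  has_ubound (M_set_XY X Y L xs ys) -> 0 <= sup (M_set_XY X Y L xs ys).
Proof.
move=> ub; have [->|/set0P[_ [y [x [s [_ [Yy [yys [Xx [Xs _]]]]]]]]]] :=
  eqVneq (M_set_XY X Y L xs ys) set0; first by rewrite sup0.
by apply: ub_le_sup => //; exists y, x, s, s; rewrite subrr dot0v.
Qed.

(** * Progress from interior strong convexity *)

(** The right side is the maximum over [a], reached at [a = g / mu]. It removes the unknown step
    length from both progress bounds. *)
Lemma parabola_le (R : realType) (mu a g : R) : 0 < mu ->
  a * g - a ^+ 2 / 2 * mu <= g ^+ 2 / (2 * mu).
Proof.
move=> mu0; rewrite ler_pdivlMr ?mulr_gt0 //.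
have := sqr_ge0 (g - mu * a); lra.
Qed.

(** The constant is tested at [u = xs], with the step length given by [ray_exitP]. The oracle point
    [sx] does at least as well as the exit point on the linear form, and [parabola_le] eliminates
    the length. *)
Lemma interior_progress (R : realType) (n m : nat) (X : set 'rV[R]_n)
  (Y : set 'rV[R]_m) (L : 'rV[R]_n -> 'rV[R]_m -> R) (xs : 'rV[R]_n) (ys : 'rV[R]_m)
  (mu : R) (x sx : 'rV[R]_n) (y : 'rV[R]_m) :
  scc_problem X Y L xs ys -> compact X -> 0 < mu ->
  (forall q, muint_set_X X Y L xs q -> mu <= q) ->
  X x -> Y y -> X sx ->
  (forall x', X x' -> dotv sx (gradx L x y) <= dotv x' (gradx L x y)) ->
  L x y - L xs y <= dotv (x - sx) (gradx L x y) ^+ 2 / (2 * mu).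
Proof.
move=> H cX mu0 muP Xx Yy Xsx sxP; have [_ _ _ _ [Xs _]] := H.
have [->|/eqP xxs] := eqVneq x xs.
  by rewrite subrr divr_ge0 ?sqr_ge0 // mulr_ge0 // ltW.
have [Ks [g [g01 eg]]] := ray_exitP cX Xx Xs xxs.
have /andP[g0 g1] := g01.
have /muP : muint_set_X X Y L xs (2 / g ^+ 2 *
    (L xs y - L x y - dotv (xs - x) (gradx L x y))).
  by exists y, x, g; do !split => //; rewrite /= -eg.
have -> : dotv (xs - x) (gradx L x y) = - g * dotv (x - ray_exit X x xs) (gradx L x y).
  by rewrite {1}eg addrAC subrr add0r dotvZl -(opprB x) dotvNl mulrN mulNr.
rewrite mulrAC ler_pdivlMr ?exprn_gt0 //.
have := parabola_le g (dotv (x - sx) (gradx L x y)) mu0.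
have := sxP _ Ks; rewrite !dotvBl.
move: (dotv sx _) (dotv (ray_exit _ _ _) _) (dotv x _) => A B D AB.
have : 0 <= g * (B - A) by rewrite mulr_ge0 ?subr_ge0 // ltW.
by move: (_ / (2 * mu)) (L x y) (L xs y) => T l l'; lra.
Qed.

(** With the exit point as [s] and [x] as [v], an interior quotient is a curvature quotient; this
    yields [mu <= C]. *)
Lemma muint_sub_curv (R : realType) (n m : nat) (X : set 'rV[R]_n)
  (Y : set 'rV[R]_m) (L : 'rV[R]_n -> 'rV[R]_m -> R) (xs : 'rV[R]_n) (ys : 'rV[R]_m) :
  scc_problem X Y L xs ys -> compact X ->
  muint_set_X X Y L xs `<=` curv_set_X X Y L.
Proof.
move=> H cX _ [y [x [g [Yy [Xx [xxs [/andP[g0 g1] ->]]]]]]].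
have [cvX _ _ _ [Xs _]] := H.
have [Ks _] := ray_exitP cX Xx Xs xxs.
exists y, x, (ray_exit X x xs), x, g; do !split => //.
  by apply: convex_set_ray => //; rewrite ltW.
by rewrite /= [X in dotv X _]addrAC subrr add0r dotvZl.
Qed.

(** * Polytopes and geometric strong convexity *)

Lemma finite_max (R : realType) (p : nat) (f : 'I_p -> R) (S : {set 'I_p}) i0 :
  i0 \in S -> exists2 i, i \in S & forall j, j \in S -> f j <= f i.
Proof. by move=> Si0; case: (arg_maxP f Si0) => i Si iP; exists i. Qed.

Lemma finite_min (R : realType) (p : nat) (f : 'I_p -> R) (i0 : 'I_p) :
  exists i, forall j, f i <= f j.
Proof.
by have [//|i _ iP] := @arg_minP _ _ _ i0 predT f; exists i => j; exact: iP.
Qed.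

Lemma conv_atom (R : realType) (k p : nat) (a : 'I_p -> 'rV[R]_k) (i : 'I_p) :
  conv_atoms a (a i).
Proof.
exists (fun j => (j == i)%:R); do !split.
- by move=> j; rewrite ler0n.
- by rewrite (bigD1 i) //= eqxx big1 ?addr0 // => j /negPf ->.
- by rewrite (bigD1 i) //= eqxx scale1r big1 ?addr0 // => j /negPf ->; rewrite scale0r.
Qed.

Lemma conv_atoms_dot_ge (R : realType) (k p : nat) (a : 'I_p -> 'rV[R]_k)
  (gr u : 'rV[R]_k) (B : R) :
  (forall i, B <= dotv gr (a i)) -> conv_atoms a u -> B <= dotv gr u.
Proof.
move=> aB [w [w0 [w1 ->]]]; rewrite dotvC dotv_suml -[B]mul1r -w1 mulr_suml.
by apply: ler_sum => i _; rewrite ler_wpM2l // dotvC.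
Qed.

Lemma conv_atoms_dot_le (R : realType) (k p : nat) (a : 'I_p -> 'rV[R]_k)
  (gr : 'rV[R]_k) (w : 'I_p -> R) (B : R) :
  (forall i, 0 <= w i) -> \sum_i w i = 1 -> (forall i, 0 < w i -> dotv gr (a i) <= B) ->
  dotv gr (\sum_i w i *: a i) <= B.
Proof.
move=> w0 w1 wB; rewrite dotvC dotv_suml -[B]mul1r -w1 mulr_suml.
apply: ler_sum => i _; have := w0 i; rewrite le_eqVlt => /orP[/eqP<-|wi].
  by rewrite !mul0r.
by rewrite ler_wpM2l // dotvC wB.
Qed.

Lemma support_rep_supp (R : realType) (k p : nat) (a : 'I_p -> 'rV[R]_k)
  (u : 'rV[R]_k) (w : 'I_p -> R) : (forall i, 0 <= w i) -> \sum_i w i = 1 ->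
  u = \sum_i w i *: a i -> support_rep a u [set i | 0 < w i]%SET.
Proof.
move=> w0 w1 uw; exists w; do !split => //; move=> i; rewrite !inE // => wi.
by apply/eqP; rewrite eq_le w0 leNgt wi.
Qed.

Lemma support_rep_nonempty (R : realType) (k p : nat) (a : 'I_p -> 'rV[R]_k)
  (u : 'rV[R]_k) (S : {set 'I_p}) : support_rep a u S -> exists i, i \in S.
Proof.
move=> [w [_ [w0 [w1 _]]]]; apply/set0Pn; apply: contra_eqN w1 => /eqP S0.
rewrite big1; first by rewrite eq_sym oner_eq0.
by move=> i _; rewrite w0 ?scale0r // S0 inE.
Qed.

(** [pfw_den] takes the least away value over all representations of [u], so the one carried by the
    algorithm can only give more. *)
Lemma pfw_den_le (R : realType) (k p : nat) (a : 'I_p -> 'rV[R]_k)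
  (gr u : 'rV[R]_k) (S : {set 'I_p}) (i j : 'I_p) :
  support_rep a u S -> i \in S -> (forall i', i' \in S -> dotv gr (a i') <= dotv gr (a i)) ->
  (forall j', dotv gr (a j) <= dotv gr (a j')) ->
  pfw_den a gr u <= dotv gr (a i) - dotv gr (a j).
Proof.
move=> uS Si iP jP; rewrite /pfw_den (@inf_image_attained _ _ _ _ j) // lerD2r.
apply: ge_inf; last by exists S; split=> //; rewrite (@sup_image_attained _ _ _ _ i).
exists (dotv gr (a j)) => _ [S' [uS' ->]].
have [i0 Si0] := support_rep_nonempty uS'.
have [i' Si' i'P] := finite_max (fun i => dotv gr (a i)) Si0.
by rewrite (@sup_image_attained _ _ _ _ i').
Qed.

(** Supports are subsets of a finite index set, so the infimum over representations is a minimum. *)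
Lemma pfw_den_attained (R : realType) (k p : nat) (a : 'I_p -> 'rV[R]_k)
  (gr u : 'rV[R]_k) : conv_atoms a u -> exists (w : 'I_p -> R) (i j : 'I_p),
  [/\ (forall i, 0 <= w i) /\ \sum_i w i = 1, u = \sum_i w i *: a i, 0 < w i,
     (forall i', 0 < w i' -> dotv gr (a i') <= dotv gr (a i)) /\
     (forall j', dotv gr (a j) <= dotv gr (a j')) &
     pfw_den a gr u = dotv gr (a i) - dotv gr (a j)].
Proof.
move=> [w0 [w00 [w01 uw0]]].
have uS0 := support_rep_supp w00 w01 uw0.
pose F (S : {set 'I_p}) := sup [set dotv gr (a i) | i in [set i | i \in S]].
have S0P : `[< support_rep a u [set i | 0 < w0 i]%SET >] by exact/asboolP.
have [S /asboolP uS SP] := @arg_minP _ _ _ _ (fun S => `[< support_rep a u S >]) F S0P.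
have [i0 Si0] := support_rep_nonempty uS.
have [i Si iP] := finite_max (fun i => dotv gr (a i)) Si0.
have [j jP] := finite_min (fun i => dotv gr (a i)) i0.
have [w [wS [wN [w1 uw]]]] := uS.
have w0' l : 0 <= w l.
  by have [/wS/ltW //|/wN ->] := boolP (l \in S).
exists w, i, j; split => //.
- exact: wS.
- split=> // i' wi'; apply: iP; apply: contraLR wi' => /wN ->.
  by rewrite ltxx.
- rewrite /pfw_den (@inf_image_attained _ _ _ _ j) //; congr (_ - _).
  have <- : F S = dotv gr (a i) by rewrite /F (@sup_image_attained _ _ _ _ i).
  rewrite -(@inf_image_attained _ _ [set S | support_rep a u S] F S) //.
    congr inf; apply/seteqP; split=> [_ [S' [uS' ->]]|_ [S' uS' <-]]; first by exists S'.
    by exists S'.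
  by move=> S' uS'; apply: SP; exact/asboolP.
Qed.

(* Moving the weight [w i] of the away atom [v_f x] onto [s_f x] gives a point at
   which [gammaA] is exactly [w i], so both quotients agree; hence [mu <= C]. *)
Lemma muA_meets_curv (R : realType) (n m p : nat) (a : 'I_p -> 'rV[R]_n)
  (Y : set 'rV[R]_m) (L : 'rV[R]_n -> 'rV[R]_m -> R) :
  muA_set_X a Y L !=set0 ->
  exists q, muA_set_X a Y L q /\ curv_set_X (conv_atoms a) Y L q.
Proof.
move=> [_ [y [x [x' [Yy [Xx [Xx' [gr0 _]]]]]]]].
set gr := gradx L x y in gr0.
have [w [i [j [[w0 w1] xw wi [iP jP] dE]]]] := pfw_den_attained gr Xx.
have xi : dotv gr x <= dotv gr (a i) by rewrite {1}xw conv_atoms_dot_le.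
have jx' := conv_atoms_dot_ge jP Xx'.
move: gr0; rewrite dotvBr => gr0.
have d0 : 0 < dotv gr (a i) - dotv gr (a j) by lra.
have Xu : conv_atoms a (x + w i *: (a j - a i)).
  exists (fun l => w l + w i * ((l == j)%:R - (l == i)%:R)); do !split.
  - move=> l; have := w0 l; have := w0 i; have [->|_] := eqVneq l i.
      by case: (_ == j) => /=; lra.
    by case: (_ == j) => /=; lra.
  - rewrite big_split /= w1 -mulr_sumr sumrB.
    rewrite (bigD1 j) //= eqxx big1 ?addr0; last by move=> l /negPf ->.
    rewrite (bigD1 i) //= eqxx big1 ?addr0; last by move=> l /negPf ->.
    by rewrite subrr mulr0 addr0.
  - under eq_bigr do rewrite scalerDl -scalerA scalerBl.
    rewrite big_split /= -xw -scaler_sumr sumrB.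
    rewrite (bigD1 j) //= eqxx scale1r big1 ?addr0; last first.
      by move=> l /negPf ->; rewrite scale0r.
    rewrite (bigD1 i) //= eqxx scale1r big1 ?addr0 //.
    by move=> l /negPf ->; rewrite scale0r.
have uE : x + w i *: (a j - a i) - x = w i *: (a j - a i) by rewrite addrAC subrr add0r.
exists (2 / w i ^+ 2 * (L (x + w i *: (a j - a i)) y - L x y -
         w i * dotv (a j - a i) gr)); split; last first.
  by exists y, x, (a j), (a i), (w i); do !split => //; exact: conv_atom.
exists y, x, (x + w i *: (a j - a i)); do !split => //.
  by rewrite uE dotvZr dotvBr pmulr_rlt0 // subr_lt0 -subr_gt0.
rewrite uE dotvZl /gammaA uE dE -/gr dotvZr dotvNl dotvBr opprB mulfK //.
by rewrite gt_eqF.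
Qed.

(** [gammaA] measures the slope towards [xs] in units of [pfw_den], which is at most the slope
    between the atoms [i] and [j]. Enlarging the unit only weakens the bound, and [parabola_le] then
    eliminates [gammaA]. *)
Lemma geometric_progress (R : realType) (n m p : nat) (a : 'I_p -> 'rV[R]_n)
  (Y : set 'rV[R]_m) (L : 'rV[R]_n -> 'rV[R]_m -> R) (xs : 'rV[R]_n) (ys : 'rV[R]_m)
  (mu : R) (w : 'I_p -> R) (i j : 'I_p) (x : 'rV[R]_n) (y : 'rV[R]_m) :
  scc_problem (conv_atoms a) Y L xs ys -> 0 < mu ->
  (forall q, muA_set_X a Y L q -> mu <= q) ->
  (forall l, 0 <= w l) -> \sum_l w l = 1 -> x = \sum_l w l *: a l -> Y y ->
  0 < w i ->
  (forall l, 0 < w l -> dotv (a l) (gradx L x y) <= dotv (a i) (gradx L x y)) ->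
  (forall x', conv_atoms a x' -> dotv (a j) (gradx L x y) <= dotv x' (gradx L x y)) ->
  L x y - L xs y <= dotv (a i - a j) (gradx L x y) ^+ 2 / (2 * mu).
Proof.
move=> H mu0 muP w0 w1 xw Yy wi; have [_ _ _ _ [Xs _]] := H.
have Xx : conv_atoms a x by exists w.
set gr := gradx L x y => iP jP.
have ge0 : 0 <= dotv (a i - a j) gr ^+ 2 / (2 * mu).
  by rewrite divr_ge0 ?sqr_ge0 // mulr_ge0 // ltW.
(* When [xs] is not in a descent direction, convexity alone makes the left side nonpositive. *)
have [neg|pos] := ltP (dotv gr (xs - x)) 0; last first.
  apply: le_trans ge0; apply: le_trans (scc_gradient_ineq H Xx Xs Yy) _.
  by rewrite -(opprB xs) dotvNl dotvC oppr_le0.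
set D := pfw_den a gr x.
have D0 : dotv gr (x - xs) <= D.
  have [w' [i' [j' [[w'0 w'1] xw' w'i [i'P j'P] dE]]]] := pfw_den_attained gr Xx.
  rewrite /D dE dotvBr lerB //; last exact: conv_atoms_dot_ge.
  by rewrite {1}xw' conv_atoms_dot_le.
have D1 : D <= dotv (a i - a j) gr.
  rewrite dotvBl !(dotvC _ gr); apply: (pfw_den_le (support_rep_supp w0 w1 xw)).
  - by rewrite inE.
  - by move=> l; rewrite inE !(dotvC gr); exact: iP.
  - by move=> l; rewrite !(dotvC gr); apply: jP; exact: conv_atom.
have xsN : dotv gr (x - xs) = - dotv gr (xs - x) by rewrite -(opprB xs) dotvNr.
have Dp : 0 < D by lra.
have /muP : muA_set_X a Y L (2 / (gammaA a gr x xs) ^+ 2 *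
    (L xs y - L x y - dotv (xs - x) gr)) by exists y, x, xs.
set ga := gammaA a gr x xs.
have gaD : ga * D = - dotv gr (xs - x).
  by rewrite /ga /gammaA dotvNl mulfVK // gt_eqF.
have ga0 : 0 < ga by rewrite -(pmulr_lgt0 _ Dp) gaD; lra.
rewrite mulrAC ler_pdivlMr ?exprn_gt0 // (dotvC (xs - x)).
have := parabola_le ga (dotv (a i - a j) gr) mu0.
have : 0 <= ga * (dotv (a i - a j) gr - D) by rewrite mulr_ge0 ?subr_ge0 // ltW.
by move: (_ / (2 * mu)) (L x y) (L xs y) (dotv gr _) gaD => T l l' c <-; lra.
Qed.

(** * The saddle-point gap of one block *)

(** At a best response [yh] the saddle property gives [L xs yh <= L xs ys], so the gap is at most
    [L x yh - L xs yh]; the gradient inequality bounds this by the numerator in [P_set_X]. *)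
Lemma primal_gap_bound (R : realType) (n m : nat) (X : set 'rV[R]_n)
  (Y : set 'rV[R]_m) (L : 'rV[R]_n -> 'rV[R]_m -> R) (xs : 'rV[R]_n) (ys : 'rV[R]_m)
  (x : 'rV[R]_n) :
  scc_problem X Y L xs ys -> compact Y -> has_ubound (P_set_X X Y L xs ys) -> X x ->
  sup [set L x y' | y' in Y] - L xs ys <=
    sup (P_set_X X Y L xs ys) * Num.sqrt (L x ys - L xs ys).
Proof.
move=> H cY ub Xx; have [_ _ dL _ [Xs [Ys sp]]] := H.
have [->|/eqP xxs] := eqVneq x xs.
  rewrite (@sup_image_attained _ _ _ _ ys) //; last first.
    by move=> y Yy; have /andP[] := sp _ _ Xs Yy.
  by rewrite !subrr sqrtr0 mulr0.
have [yh Yh yhP] : exists2 c, c \in Y & forall t, t \in Y -> L x t <= L x c.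
  apply: compact_EVT_max => //; first by exists ys.
  apply: continuous_in_subspaceT => y; rewrite inE => Yy.
  exact: (differentiable_continuous (dL _ _ Xx Yy).2).
rewrite inE in Yh.
have {}yhP y : Y y -> L x y <= L x yh by move=> Yy; apply: yhP; rewrite inE.
rewrite (@sup_image_attained _ _ _ _ yh) //.
have w0 := saddle_unique H Xx xxs; rewrite -subr_gt0 in w0.
have : P_set_X X Y L xs ys (dotv (gradx L x yh) (x - xs) / Num.sqrt (L x ys - L xs ys)).
  by exists x, yh.
move/(ub_le_sup ub); rewrite ler_pdivrMr ?sqrtr_gt0 //; apply: le_trans.
rewrite dotvC; apply: le_trans (scc_gradient_ineq H Xx Xs Yh).
by rewrite lerB //; have /andP[] := sp _ _ Xs Yh.
Qed.

Lemma P_X_ge0 (R : realType) (n m : nat) (X : set 'rV[R]_n)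
  (Y : set 'rV[R]_m) (L : 'rV[R]_n -> 'rV[R]_m -> R) (xs : 'rV[R]_n) (ys : 'rV[R]_m) :
  scc_problem X Y L xs ys -> has_ubound (P_set_X X Y L xs ys) ->
  0 <= sup (P_set_X X Y L xs ys).
Proof.
move=> H ub; have [_ _ _ _ [Xs [Ys sp]]] := H.
have [->|/set0P[q Pq]] := eqVneq (P_set_X X Y L xs ys) set0; first by rewrite sup0.
apply: le_trans (ub_le_sup ub Pq).
have [x [yh [Xx [_ [Yh [yhP ->]]]]]] := Pq.
rewrite divr_ge0 ?sqrtr_ge0 // dotvC.
apply: le_trans (scc_gradient_ineq H Xx Xs Yh).
have /andP[A _] := sp _ _ Xs Yh; have /andP[_ B] := sp _ _ Xx Ys.
by rewrite subr_ge0 (le_trans A) // (le_trans B) // yhP.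
Qed.

(** * The constants under exchange of the players *)

Lemma subrNN (V : zmodType) (a b : V) : - a - - b = b - a.
Proof. by rewrite opprK addrC. Qed.

Lemma curv_set_flip (R : realType) (n m : nat) (X : set 'rV[R]_n) (Y : set 'rV[R]_m)
  (L : 'rV[R]_n -> 'rV[R]_m -> R) (xs : 'rV[R]_n) (ys : 'rV[R]_m) :
  scc_problem X Y L xs ys -> curv_set_X Y X (flip L) = curv_set_Y X Y L.
Proof.
move=> H; apply/seteqP; split=> q [x [y [s [v [g [Xx [Yy [Ys [Yv [g0 [Yu ->]]]]]]]]]]];
  exists x, y, s, v, g; do !split => //;
  by rewrite (gradx_flip H Xx Yy) dotvNr mulrN /flip !opprK.
Qed.

Lemma muint_set_flip (R : realType) (n m : nat) (X : set 'rV[R]_n) (Y : set 'rV[R]_m)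
  (L : 'rV[R]_n -> 'rV[R]_m -> R) (xs : 'rV[R]_n) (ys : 'rV[R]_m) :
  scc_problem X Y L xs ys -> muint_set_X Y X (flip L) ys = muint_set_Y X Y L ys.
Proof.
move=> H; apply/seteqP; split=> q [x [y [g [Xx [Yy [yys [g0 ->]]]]]]];
  exists x, y, g; do !split => //;
  by rewrite /= (gradx_flip H Xx Yy) dotvNr /flip !opprK.
Qed.

Lemma muA_set_flip (R : realType) (n m p : nat) (X : set 'rV[R]_n)
  (b : 'I_p -> 'rV[R]_m)
  (L : 'rV[R]_n -> 'rV[R]_m -> R) (xs : 'rV[R]_n) (ys : 'rV[R]_m) :
  scc_problem X (conv_atoms b) L xs ys -> muA_set_X b X (flip L) = muA_set_Y X b L.
Proof.
move=> H; apply/seteqP; split=> q [x [y [y' [Xx [Yy [Yy' [neg ->]]]]]]];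
  exists x, y, y'; move: neg; do !split => //; move: neg;
  by rewrite (gradx_flip H Xx Yy) // /flip !opprK.
Qed.

Lemma M_set_flip (R : realType) (n m : nat) (X : set 'rV[R]_n) (Y : set 'rV[R]_m)
  (L : 'rV[R]_n -> 'rV[R]_m -> R) (xs : 'rV[R]_n) (ys : 'rV[R]_m) :
  scc_problem X Y L xs ys -> M_set_XY Y X (flip L) ys xs = M_set_YX X Y L xs ys.
Proof.
move=> H; have [_ _ _ _ [Xs [Ys _]]] := H.
apply/seteqP; split=> q [x [y [s [v [Xx [xxs [Yy [Ys' [Yv ->]]]]]]]]];
  exists x, y, s, v;
  by rewrite (gradx_flip H Xx Yy) (gradx_flip H Xs Yy) /flip !subrNN; do !split.
Qed.

Lemma P_set_flip (R : realType) (n m : nat) (X : set 'rV[R]_n) (Y : set 'rV[R]_m)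
  (L : 'rV[R]_n -> 'rV[R]_m -> R) (xs : 'rV[R]_n) (ys : 'rV[R]_m) :
  scc_problem X Y L xs ys -> P_set_X Y X (flip L) ys xs = P_set_Y X Y L xs ys.
Proof.
move=> H; apply/seteqP; split=> q [y [xh [Yy [yys [Xh [xhP ->]]]]]];
  exists y, xh; do !split => //.
- by move=> x' Xx'; have := xhP _ Xx'; rewrite /flip lerN2.
- by rewrite (gradx_flip H Xh Yy) dotvNl -dotvNr opprB /flip subrNN.
- by move=> x' Xx'; rewrite /flip lerN2 xhP.
- by rewrite (gradx_flip H Xh Yy) dotvNl -dotvNr opprB /flip subrNN.
Qed.

(** * Descent of the merit *)

(** Merging the square roots of the two blocks is the source of the factor 2 under the root, in the
    descent and in the bound on [hgap]. *)
Lemma sqrt_add_le (R : realType) (A B : R) : 0 <= A -> 0 <= B ->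
  Num.sqrt A + Num.sqrt B <= Num.sqrt (2 * (A + B)).
Proof.
move=> A0 B0; rewrite -[leLHS]ger0_norm ?addr_ge0 ?sqrtr_ge0 // -sqrtr_sqr.
apply: ler_wsqrtr; have := sqr_sqrtr A0; have := sqr_sqrtr B0.
have := sqr_ge0 (Num.sqrt A - Num.sqrt B).
move: (Num.sqrt A) (Num.sqrt B) => a b; lra.
Qed.

Lemma wgap_parts_ge0 (R : realType) (n m : nat) (X : set 'rV[R]_n) (Y : set 'rV[R]_m)
  (L : 'rV[R]_n -> 'rV[R]_m -> R) (xs : 'rV[R]_n) (ys : 'rV[R]_m) x y :
  saddle_point X Y L xs ys -> X x -> Y y ->
  0 <= L x ys - L xs ys /\ 0 <= L xs ys - L xs y.
Proof. by move=> [_ [_ sp]] Xx Yy; have /andP[] := sp _ _ Xx Yy; rewrite !subr_ge0. Qed.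

Lemma wgap_ge0 (R : realType) (n m : nat) (X : set 'rV[R]_n) (Y : set 'rV[R]_m)
  (L : 'rV[R]_n -> 'rV[R]_m -> R) (xs : 'rV[R]_n) (ys : 'rV[R]_m) x y :
  saddle_point X Y L xs ys -> X x -> Y y -> 0 <= wgap L xs ys x y.
Proof.
by move=> sp Xx Yy; have [] := wgap_parts_ge0 sp Xx Yy; rewrite /wgap; lra.
Qed.

Lemma M_L_ge0 (R : realType) (n m : nat) (X : set 'rV[R]_n) (Y : set 'rV[R]_m)
  (L : 'rV[R]_n -> 'rV[R]_m -> R) (xs : 'rV[R]_n) (ys : 'rV[R]_m) :
  has_ubound (M_set_XY X Y L xs ys) -> 0 <= M_L X Y L xs ys.
Proof. by move=> ub; rewrite /M_L le_max M_XY_ge0. Qed.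

(* The gradients at [(x, ys)] and [(xs, y)] supplied by the curvature bounds are
   replaced by those at [(x, y)]; the error is what [M_L] controls. *)
Lemma wgap_descent (R : realType) (n m : nat) (X : set 'rV[R]_n) (Y : set 'rV[R]_m)
  (L : 'rV[R]_n -> 'rV[R]_m -> R) (xs : 'rV[R]_n) (ys : 'rV[R]_m)
  (x s v : 'rV[R]_n) (y s' v' : 'rV[R]_m) (g : R) :
  scc_problem X Y L xs ys ->
  has_ubound (curv_set_X X Y L) -> has_ubound (curv_set_Y X Y L) ->
  has_ubound (M_set_XY X Y L xs ys) -> has_ubound (M_set_YX X Y L xs ys) ->
  X x -> X s -> X v -> Y y -> Y s' -> Y v' -> 0 <= g ->
  X (x + g *: (s - v)) -> Y (y + g *: (s' - v')) ->
  wgap L xs ys (x + g *: (s - v)) (y + g *: (s' - v')) <=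
    wgap L xs ys x y + g * rdot L x y (s - v) (s' - v')
    + g * (M_L X Y L xs ys * Num.sqrt (2 * wgap L xs ys x y))
    + g ^+ 2 * curvature X Y L.
Proof.
move=> H ucX ucY uMX uMY Xx Xs Xv Yy Ys' Yv' g0 Xu Yu.
have [_ _ _ _ sp] := H; have [Xss [Yss _]] := sp.
have cX := curvature_bound ucX Xx Xs Xv Yss g0 Xu.
rewrite -(curv_set_flip H) in ucY; rewrite -(M_set_flip H) in uMY.
have cY := curvature_bound ucY Yy Ys' Yv' Xss g0 Yu.
have mX := bilinearity_bound H uMX Xx Xs Xv Yy.
have mY := bilinearity_bound (scc_flip H) uMY Yy Ys' Yv' Xx.
have [wx wy] := wgap_parts_ge0 sp Xx Yy.
have sq := sqrt_add_le wx wy.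
have eW : L x ys - L xs ys + (L xs ys - L xs y) = wgap L xs ys x y.
  by rewrite /wgap; lra.
rewrite eW in sq.
move: cY mY; rewrite (gradx_flip H Xx Yy) (gradx_flip H Xss Yy) /flip.
rewrite !subrNN dotvNr dotvBr => cY mY.
rewrite dotvBr in mX.
have [MX MY] : sup (M_set_XY X Y L xs ys) <= M_L X Y L xs ys /\
    sup (M_set_XY Y X (flip L) ys xs) <= M_L X Y L xs ys.
  by rewrite (M_set_flip H) /M_L !le_max !lexx orbT.
have M0 : 0 <= M_L X Y L xs ys by exact: M_L_ge0.
have eX : sup (M_set_XY X Y L xs ys) * Num.sqrt (L xs ys - L xs y) <=
  M_L X Y L xs ys * Num.sqrt (L xs ys - L xs y) by rewrite ler_wpM2r ?sqrtr_ge0.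
have eY : sup (M_set_XY Y X (flip L) ys xs) * Num.sqrt (L x ys - L xs ys) <=
  M_L X Y L xs ys * Num.sqrt (L x ys - L xs ys) by rewrite ler_wpM2r ?sqrtr_ge0.
have eM := ler_wpM2l M0 sq.
have key : dotv (s - v) (gradx L x ys) - dotv (s' - v') (grady L xs y) <=
    rdot L x y (s - v) (s' - v') + M_L X Y L xs ys * Num.sqrt (2 * wgap L xs ys x y).
  by rewrite /rdot; lra.
have := ler_wpM2l g0 key.
have -> : curvature X Y L = (sup (curv_set_X X Y L) + sup (curv_set_X Y X (flip L))) / 2.
  by rewrite (curv_set_flip H).
rewrite {2}/wgap /wgap -/(wgap L xs ys x y).
by move: cX cY; rewrite /wgap; lra.
Qed.

(** The gradient inequalities bound the merit by the linear form towards [(xs, ys)], and the oracle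
    point does at least as well. Steps clipped at 1 rely on this linear bound. *)
Lemma wgap_le_gap_fw (R : realType) (n m : nat) (X : set 'rV[R]_n) (Y : set 'rV[R]_m)
  (L : 'rV[R]_n -> 'rV[R]_m -> R) (xs : 'rV[R]_n) (ys : 'rV[R]_m)
  (x sx : 'rV[R]_n) (y sy : 'rV[R]_m) :
  scc_problem X Y L xs ys -> X x -> Y y ->
  (forall x' y', X x' -> Y y' -> rdot L x y sx sy <= rdot L x y x' y') ->
  wgap L xs ys x y <= gap_fw L x y sx sy.
Proof.
move=> H Xx Yy sP; have [_ _ _ _ [Xs [Ys _]]] := H.
have := scc_gradient_ineq H Xx Xs Yy.
have := scc_gradient_ineq (scc_flip H) Yy Ys Xx.
rewrite (gradx_flip H Xx Yy) /flip dotvNr !dotvBl.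
by have := sP _ _ Xs Ys; rewrite /gap_fw /rdot /wgap; lra.
Qed.

(** * Real inequalities for a single step *)

Lemma sqrD_le (R : realType) (a b mu : R) : 0 <= a -> 0 <= b -> 0 < mu ->
  a ^+ 2 / (2 * mu) + b ^+ 2 / (2 * mu) <= (a + b) ^+ 2 / (2 * mu).
Proof.
move=> a0 b0 mu0; rewrite -mulrDl ler_pM2r ?invr_gt0 ?mulr_gt0 //.
by rewrite sqrrD; have := mulr_ge0 a0 b0; lra.
Qed.

(* [gap_le C nu g V] is the disjunction behind
   [g <= 2 * max (sqrt C) (sqrt V) / nu * sqrt V]: the first case comes from an
   unconstrained step, the second one from a step clipped at 1. *)
Definition gap_le (R : realType) (C nu g V : R) : Prop :=
  nu ^+ 2 * g ^+ 2 <= 4 * (C * V) \/ nu * g <= 2 * V.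

Lemma gap_le_trans (R : realType) (C nu g V V' : R) : 0 <= C -> V <= V' ->
  gap_le C nu g V -> gap_le C nu g V'.
Proof.
move=> C0 VV' [h|h]; [left|right]; last by lra.
by have := ler_wpM2l C0 VV'; lra.
Qed.

Lemma gap_leP (R : realType) (C nu g V : R) : 0 <= C -> 0 < nu -> 0 <= g -> 0 <= V ->
  gap_le C nu g V -> g <= 2 * Num.max (Num.sqrt C) (Num.sqrt V) / nu * Num.sqrt V.
Proof.
move=> C0 nu0 g0 V0 h; rewrite mulrAC ler_pdivlMr //.
have sV := sqrtr_ge0 V; have eV := sqr_sqrtr V0.
have [A B] : Num.sqrt C <= Num.max (Num.sqrt C) (Num.sqrt V) /\
  Num.sqrt V <= Num.max (Num.sqrt C) (Num.sqrt V) by rewrite !le_max !lexx orbT.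
have {}A := ler_wpM2r sV A; have {}B := ler_wpM2r sV B.
case: h => h; last by rewrite expr2 in eV; lra.
have : nu * g <= 2 * (Num.sqrt C * Num.sqrt V); last by lra.
rewrite -(@ler_pXn2r _ 2) // ?nnegrE ?mulr_ge0 ?sqrtr_ge0 ?(ltW nu0) //.
rewrite !exprMn !sqr_sqrtr //; lra.
Qed.

(** [nu / (2 * C) * g] maximises the guaranteed decrease as a function of [gam], so a shorter step
    still decreases the merit. A drop step offers no more than this. *)
Lemma unconstrained_step_le (R : realType) (C nu g gam W W' : R) : 0 < C ->
  0 <= gam -> gam <= nu / (2 * C) * g -> W' <= W - nu * gam * g + gam ^+ 2 * C ->
  0 <= nu * g -> W' <= W.
Proof.
move=> C0 gam0 gamle h ng0.
have : gam * C <= nu * g / 2.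
  have := ler_wpM2r (ltW C0) gamle.
  by rewrite (_ : nu / (2 * C) * g * C = nu * g / 2) //; field; rewrite gt_eqF.
move=> /(ler_wpM2l gam0); have := mulr_ge0 gam0 ng0; rewrite expr2 in h; lra.
Qed.

(** A step clipped at 1 contracts by [1 - nu / 2]; the upper bound makes this at least as good as
    the claimed rate. *)
Lemma rho_le (R : realType) (C mu nu : R) : 0 < C -> 0 < mu -> mu <= C -> 0 < nu ->
  nu <= 1 -> 0 < nu ^+ 2 * mu / (2 * C) <= nu / 2.
Proof.
move=> C0 mu0 muC nu0 nu1; rewrite divr_gt0 ?mulr_gt0 ?exprn_gt0 //=.
rewrite ler_pdivrMr ?mulr_gt0 //.
have : nu * mu <= C by apply: le_trans muC; rewrite ler_piMl // ltW.
by move=> /(ler_wpM2l (ltW nu0)); lra.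
Qed.

Lemma rho_mul_le (R : realType) (C mu nu g W : R) : 0 < C -> 0 < mu ->
  W <= g ^+ 2 / (2 * mu) ->
  nu ^+ 2 * mu / (2 * C) * W <= nu ^+ 2 * (g ^+ 2 / (4 * C)).
Proof.
move=> C0 mu0; rewrite ler_pdivlMr ?mulr_gt0 // => Wg.
have -> : nu ^+ 2 * mu / (2 * C) * W = nu ^+ 2 / (4 * C) * (W * (2 * mu)).
  by field; rewrite gt_eqF.
have -> : nu ^+ 2 * (g ^+ 2 / (4 * C)) = nu ^+ 2 / (4 * C) * g ^+ 2.
  by field; rewrite gt_eqF.
by rewrite ler_wpM2l // divr_ge0 ?sqr_ge0 // mulr_ge0 // ltW.
Qed.

Lemma non_drop_step (R : realType) (C mu nu g gam W W' : R) :
  0 < C -> 0 < mu -> mu <= C -> 0 < nu -> nu <= 1 ->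
  0 <= W -> 0 <= W' -> W <= g -> W <= g ^+ 2 / (2 * mu) ->
  gam = nu / (2 * C) * g \/ (gam = 1 /\ 1 <= nu / (2 * C) * g) ->
  W' <= W - nu * gam * g + gam ^+ 2 * C ->
  W' <= (1 - nu ^+ 2 * mu / (2 * C)) * W /\ gap_le C nu g W.
Proof.
move=> C0 mu0 muC nu0 nu1 W0 W'0 Wg Wg2 gamE h.
have /andP[rho0 rho1] := rho_le C0 mu0 muC nu0 nu1.
have rW := ler_wpM2r W0 rho1.
have nW := ler_wpM2l (ltW nu0) Wg.
case: gamE => [gamE|[gamE gC]]; last first.
  (* Clipping means that the quadratic term costs at most half of the linear one. *)
  have : C <= nu * g / 2.
    have := ler_wpM2r (ltW C0) gC.
    by rewrite (_ : nu / (2 * C) * g * C = nu * g / 2) ?mul1r //; field; rewrite gt_eqF.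
  by move: h; rewrite gamE => h hC; split; [|right]; lra.
have {}h : W' <= W - nu ^+ 2 * g ^+ 2 / (4 * C).
  apply: le_trans h _; rewrite gamE.
  have -> // : W - nu * (nu / (2 * C) * g) * g + (nu / (2 * C) * g) ^+ 2 * C =
    W - nu ^+ 2 * g ^+ 2 / (4 * C) by field; rewrite gt_eqF.
split.
  rewrite mulrBl mul1r; apply: le_trans h _; rewrite lerB //.
  by rewrite -[leRHS]mulrA; exact: rho_mul_le.
left; have : nu ^+ 2 * g ^+ 2 / (4 * C) <= W by lra.
by rewrite ler_pdivrMr ?mulr_gt0 //; lra.
Qed.

(* At the first step the away gap vanishes, so the descent holds with
   [nu + 1/2]; this gains one extra factor [1 - rho]. *)
Lemma first_step (R : realType) (C mu nu g gam W W' : R) :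
  0 < C -> 0 < mu -> mu <= C -> 0 < nu -> nu <= 1 ->
  0 <= W -> 0 <= W' -> W <= g -> W <= g ^+ 2 / (2 * mu) ->
  gam = nu / (2 * C) * g \/ (gam = 1 /\ 1 <= nu / (2 * C) * g) ->
  W' <= W - (nu + 2^-1) * gam * g + gam ^+ 2 * C ->
  W' <= (1 - nu ^+ 2 * mu / (2 * C)) ^+ 2 * W /\
  gap_le C nu g ((1 - nu ^+ 2 * mu / (2 * C)) * W).
Proof.
move=> C0 mu0 muC nu0 nu1 W0 W'0 Wg Wg2 gamE h.
have /andP[rho0 rho1] := rho_le C0 mu0 muC nu0 nu1.
have rW := ler_wpM2r W0 rho1.
have nW := ler_wpM2l (ltW nu0) Wg.
have nW1 := ler_wpM2r W0 nu1.
have g0 : 0 <= g by exact: le_trans Wg.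
have ng1 := ler_wpM2r g0 nu1.
have sq : 0 <= (nu ^+ 2 * mu / (2 * C)) ^+ 2 * W by rewrite mulr_ge0 ?sqr_ge0.
set rho := nu ^+ 2 * mu / (2 * C) in rho0 rho1 rW sq *.
(* Since [rho <= 1/2], it suffices for the gap bound to reach [W / 2]. *)
have half : W / 2 <= (1 - rho) * W by lra.
have suff2 : W' <= W - 2 * (rho * W) -> W' <= (1 - rho) ^+ 2 * W by lra.
case: gamE => [gamE|[gamE gC]]; last first.
  have : C <= nu * g / 2.
    have := ler_wpM2r (ltW C0) gC.
    by rewrite (_ : nu / (2 * C) * g * C = nu * g / 2) ?mul1r //; field; rewrite gt_eqF.
  move: h; rewrite gamE => h hC; split; [apply: suff2|right]; lra.
have {}h : W' <= W - (nu ^+ 2 + nu) * g ^+ 2 / (4 * C).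
  apply: le_trans h _; rewrite gamE.
  have -> // : W - (nu + 2^-1) * (nu / (2 * C) * g) * g + (nu / (2 * C) * g) ^+ 2 * C =
    W - (nu ^+ 2 + nu) * g ^+ 2 / (4 * C) by field; rewrite gt_eqF.
(* The extra 1/2 contributes [nu * g ^+ 2 / (4 * C)], which is at least the ordinary decrease; the
   decrease is thus doubled. *)
have nu2 : nu ^+ 2 <= nu by rewrite expr2 ler_piMl // ltW.
have : 2 * (nu ^+ 2 * (g ^+ 2 / (4 * C))) <= (nu ^+ 2 + nu) * g ^+ 2 / (4 * C).
  rewrite -[(nu ^+ 2 + nu) * _ / _]mulrA mulrA ler_wpM2r //; last by lra.
  by rewrite divr_ge0 ?sqr_ge0 // mulr_ge0 // ltW.
have : rho * W <= nu ^+ 2 * (g ^+ 2 / (4 * C)).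
  exact: rho_mul_le.
move=> A B; split; first by apply: suff2; lra.
left; have : nu ^+ 2 * (g ^+ 2 / (4 * C)) <= W / 2 by lra.
rewrite mulrA ler_pdivrMr ?mulr_gt0 // => D.
by have := ler_wpM2l (ltW C0) half; lra.
Qed.

(** * From the merit to the saddle-point gap *)

Lemma sqrt_geometric (R : realType) (w r : R) (k : nat) : 0 <= w -> 0 <= r ->
  Num.sqrt (w * r ^+ k) = Num.sqrt w * r `^ (k%:R / 2).
Proof.
by move=> w0 r0; rewrite sqrtrM // powRrM powR_mulrn // powR12_sqrt // exprn_ge0.
Qed.

Lemma hgap_bound (R : realType) (n m : nat) (X : set 'rV[R]_n) (Y : set 'rV[R]_m)
  (L : 'rV[R]_n -> 'rV[R]_m -> R) (xs : 'rV[R]_n) (ys : 'rV[R]_m) x y (V : R) :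
  scc_problem X Y L xs ys -> compact X -> compact Y ->
  has_ubound (P_set_X X Y L xs ys) -> has_ubound (P_set_Y X Y L xs ys) ->
  X x -> Y y -> wgap L xs ys x y <= V ->
  hgap X Y L x y <= P_L X Y L xs ys * Num.sqrt (2 * V).
Proof.
move=> H cX cY uX uY Xx Yy wV; have [_ _ _ _ sp] := H.
have pX := primal_gap_bound H cY uX Xx.
have P0 := P_X_ge0 H uX.
rewrite -(P_set_flip H) in uY.
have pY := primal_gap_bound (scc_flip H) cX uY Yy.
have [wx wy] := wgap_parts_ge0 sp Xx Yy.
have [PX PY] : sup (P_set_X X Y L xs ys) <= P_L X Y L xs ys /\
    sup (P_set_X Y X (flip L) ys xs) <= P_L X Y L xs ys.
  by rewrite (P_set_flip H) /P_L !le_max !lexx orbT.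
have PL0 := le_trans P0 PX.
have eX := ler_wpM2r (sqrtr_ge0 (L x ys - L xs ys)) PX.
have eY := ler_wpM2r (sqrtr_ge0 (L xs ys - L xs y)) PY.
have sq := ler_wpM2l PL0 (sqrt_add_le wx wy).
have mono : P_L X Y L xs ys * Num.sqrt (2 * (L x ys - L xs ys + (L xs ys - L xs y))) <=
    P_L X Y L xs ys * Num.sqrt (2 * V).
  by rewrite ler_wpM2l // ler_wsqrtr // ler_pM2l //; move: wV; rewrite /wgap; lra.
(* [inf] is minus the [sup] of the negated set, which turns the minimisation part into the primal
   gap of the flipped problem. *)
rewrite /hgap /inf (_ : -%R @` _ = [set flip L y x' | x' in X]); last first.
  by apply/seteqP; split=> [_ [_ [x' Xx' <-] <-]|_ [x' Xx' <-]];
    [exists x' | exists (L x' y) => //; exists x'].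
move: pY; rewrite /flip subrNN opprK => pY.
by lra.
Qed.

(** * Linear rate of SP-FW *)

Definition bounded_problem (R : realType) (n m : nat) (X : set 'rV[R]_n)
  (Y : set 'rV[R]_m) (L : 'rV[R]_n -> 'rV[R]_m -> R) (xs : 'rV[R]_n) (ys : 'rV[R]_m) : Prop :=
  [/\ scc_problem X Y L xs ys, compact X /\ compact Y,
      has_ubound (curv_set_X X Y L) /\ has_ubound (curv_set_Y X Y L) &
      has_ubound (M_set_XY X Y L xs ys) /\ has_ubound (M_set_YX X Y L xs ys)].

Lemma bilinearity_term_le (R : realType) (mu M g w : R) :
  0 < mu -> 0 <= M -> 0 <= g -> w <= g ^+ 2 / (2 * mu) ->
  M * Num.sqrt (2 * w) <= M / Num.sqrt mu * g.
Proof.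
move=> mu0 M0 g0 wg; rewrite -mulrA ler_wpM2l //.
rewrite [leRHS]mulrC ler_pdivlMr ?sqrtr_gt0 // mulrC -sqrtrM ?(ltW mu0) //.
rewrite -[leRHS]ger0_norm // -sqrtr_sqr ler_wsqrtr //.
by move: wg; rewrite ler_pdivlMr ?mulr_gt0 //; lra.
Qed.

Lemma nu_le (R : realType) (c M mu : R) : 0 <= M -> c - M / Num.sqrt mu <= c.
Proof. by move=> M0; rewrite gerBl divr_ge0 ?sqrtr_ge0. Qed.

Lemma le_curvature (R : realType) (n m : nat) (X : set 'rV[R]_n)
  (Y : set 'rV[R]_m) (L : 'rV[R]_n -> 'rV[R]_m -> R) (xs : 'rV[R]_n) (ys : 'rV[R]_m)
  (mu qx qy : R) :
  bounded_problem X Y L xs ys -> mu <= qx -> curv_set_X X Y L qx ->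
  mu <= qy -> curv_set_X Y X (flip L) qy -> mu <= curvature X Y L.
Proof.
move=> [H _ [ucX ucY] _] mx cx my cy.
rewrite (curv_set_flip H) in cy.
by have := ub_le_sup ucX cx; have := ub_le_sup ucY cy; rewrite /curvature; lra.
Qed.

Lemma step_size_clipped (R : realType) (gm q : R) :
  Num.min gm q = q \/ (Num.min gm q = gm /\ gm <= q).
Proof. by case: (leP gm q) => h; [right|left]. Qed.

Lemma rdot_fw_direction (R : realType) (n m : nat) (L : 'rV[R]_n -> 'rV[R]_m -> R) x y sx sy :
  rdot L x y (sx - x) (sy - y) = - gap_fw L x y sx sy.
Proof. by rewrite /rdot /gap_fw /rdot !dotvBl; lra. Qed.

Lemma rdot_away_direction (R : realType) (n m : nat) (L : 'rV[R]_n -> 'rV[R]_m -> R) x y vx vy :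
  rdot L x y (x - vx) (y - vy) = - gap_away L x y vx vy.
Proof. by rewrite /rdot /gap_away /rdot !dotvBl; lra. Qed.

Lemma combineE (R : realType) (k : nat) (x s : 'rV[R]_k) (g : R) :
  (1 - g) *: x + g *: s = x + g *: (s - x).
Proof. by rewrite scalerBl scale1r scalerBr addrAC addrA. Qed.

Lemma sp_fw_linear_rate (R : realType) (n m : nat) (X : set 'rV[R]_n)
  (Y : set 'rV[R]_m) (L : 'rV[R]_n -> 'rV[R]_m -> R) (xs : 'rV[R]_n) (ys : 'rV[R]_m)
  (C mu nu : R) (x sx : nat -> 'rV[R]_n) (y sy : nat -> 'rV[R]_m) :
  bounded_problem X Y L xs ys ->
  C = curvature X Y L -> mu = mu_int X Y L xs ys -> 0 < mu ->
  nu = 1 - M_L X Y L xs ys / Num.sqrt mu -> 0 < nu ->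
  sp_fw_run X Y L nu C x y sx sy ->
  let w t := wgap L xs ys (x t) (y t) in
  let rho := nu ^+ 2 * mu / (2 * C) in
  [/\ 0 < C, 0 <= rho <= 2^-1 &
      forall t, [/\ X (x t) /\ Y (y t), 0 <= w t,
        0 <= gap_fw L (x t) (y t) (sx t) (sy t),
        w t.+1 <= (1 - rho) * w t &
        gap_le C nu (gap_fw L (x t) (y t) (sx t) (sy t)) (w t)]].
Proof.
move=> B CE muE mu0 nuE nu0 [X0 [Y0 run]] w rho.
have [H [cX cY] [ucX ucY] [uMX uMY]] := B.
have HF := scc_flip H.
have [cvX cvY _ _ sp] := H.
have [mX0 mY0] : 0 < inf (muint_set_X X Y L xs) /\ 0 < inf (muint_set_Y X Y L ys).
  by move: mu0; rewrite muE /mu_int lt_min => /andP.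
have muX q : muint_set_X X Y L xs q -> mu <= q.
  by move=> /(inf_le_mem mX0); apply: le_trans; rewrite muE /mu_int ge_min lexx.
have muY q : muint_set_X Y X (flip L) ys q -> mu <= q.
  rewrite (muint_set_flip H) => /(inf_le_mem mY0); apply: le_trans.
  by rewrite muE /mu_int ge_min lexx orbT.
have muC : mu <= C.
  have [qx Qx] := inf_gt0_nonempty mX0; have [qy Qy] := inf_gt0_nonempty mY0.
  rewrite -(muint_set_flip H) in Qy.
  rewrite CE; apply: (le_curvature B (muX _ Qx) _ (muY _ Qy)).
    exact: (muint_sub_curv H cX).
  exact: (muint_sub_curv HF cY).
have C0 : 0 < C by exact: lt_le_trans muC.
have M0 : 0 <= M_L X Y L xs ys by exact: M_L_ge0.
have nu1 : nu <= 1 by rewrite nuE nu_le.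
have /andP[rho0 rho1] := rho_le C0 mu0 muC nu0 nu1.
have fwgap t : X (x t) -> Y (y t) -> w t <= gap_fw L (x t) (y t) (sx t) (sy t).
  by move=> Xx Yy; have [_ [_ [sP _]]] := run t; exact: (wgap_le_gap_fw H).
have gam01 t : X (x t) -> Y (y t) ->
    0 <= Num.min 1 (nu / (2 * C) * gap_fw L (x t) (y t) (sx t) (sy t)) <= 1.
  move=> Xx Yy; rewrite ge_min lexx le_min ler01 /=.
  rewrite andbT mulr_ge0 ?(le_trans (wgap_ge0 sp Xx Yy) (fwgap _ Xx Yy)) //.
  by rewrite divr_ge0 ?mulr_ge0 // ltW.
have XY t : X (x t) /\ Y (y t).
  elim: t => [//|t [Xx Yy]]; have [Xs [Ys [_ [-> ->]]]] := run t.
  by split; apply: convex_setE => //; exact: gam01.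
split=> //; first by rewrite (ltW rho0) /= /rho; lra.
move=> t; have [Xx Yy] := XY t; have [Xsx [Ysy [sP [xE yE]]]] := run t.
have w0 : 0 <= w t by exact: wgap_ge0 sp Xx Yy.
have w'0 : 0 <= w t.+1 by have [Xx' Yy'] := XY t.+1; exact: wgap_ge0 sp Xx' Yy'.
have wg := fwgap t Xx Yy; have /andP[gam0 gam1] := gam01 t Xx Yy.
move: (XY t.+1) w'0; rewrite /w xE yE !combineE.
set g := gap_fw _ _ _ _ _ in wg gam0 gam1 *; set gam := Num.min 1 _ in gam0 gam1 *.
move=> [Xx' Yy'] w'0.
have g0 := le_trans w0 wg.
have des := wgap_descent H ucX ucY uMX uMY Xx Xsx Xx Yy Ysy Yy gam0 Xx' Yy'.
rewrite rdot_fw_direction -CE -/g -/(w t) in des.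
have sPx x' : X x' -> dotv (sx t) (gradx L (x t) (y t)) <= dotv x' (gradx L (x t) (y t)).
  by move=> Xx''; have := sP _ _ Xx'' Ysy; rewrite /rdot lerD2r.
have sPy y' : Y y' -> dotv (sy t) (gradx (flip L) (y t) (x t)) <=
    dotv y' (gradx (flip L) (y t) (x t)).
  move=> Yy''; have := sP _ _ Xsx Yy''.
  by rewrite (gradx_flip H Xx Yy) !dotvNr /rdot lerD2l.
have px := interior_progress H cX mu0 muX Xx Yy Xsx sPx.
have py := interior_progress HF cY mu0 muY Yy Xx Ysy sPy.
have gx0 : 0 <= dotv (x t - sx t) (gradx L (x t) (y t)).
  by rewrite dotvBl subr_ge0 sPx.
have gy0 : 0 <= dotv (y t - sy t) (gradx (flip L) (y t) (x t)).
  by rewrite dotvBl subr_ge0 sPy.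
have gE : dotv (x t - sx t) (gradx L (x t) (y t)) +
    dotv (y t - sy t) (gradx (flip L) (y t) (x t)) = g.
  by rewrite /g /gap_fw /rdot (gradx_flip H Xx Yy) dotvNr !dotvBl; lra.
have wg2 : w t <= g ^+ 2 / (2 * mu).
  have := sqrD_le gx0 gy0 mu0; rewrite gE.
  by move: px py; rewrite /w /wgap /flip; lra.
have bil := ler_wpM2l gam0 (bilinearity_term_le mu0 M0 g0 wg2).
(* The bilinearity error is [M / sqrt mu] times [gam * g], exactly what [nu] subtracts from 1. *)
have step : wgap L xs ys (x t + gam *: (sx t - x t)) (y t + gam *: (sy t - y t)) <=
    w t - nu * gam * g + gam ^+ 2 * C.
  by apply: le_trans des _; rewrite nuE; lra.
have [] := non_drop_step C0 mu0 muC nu0 nu1 w0 w'0 wg wg2 _ step; last by [].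
exact: step_size_clipped.
Qed.

(** * Accumulation over drop and non-drop steps *)

Lemma geometric_decay (R : realType) (r : R) (w : nat -> R) (nd : nat -> bool) :
  0 <= r ->
  (forall t, w t.+1 <= w t) -> (forall t, nd t -> w t.+1 <= r * w t) ->
  forall t, w t <= w 0%N * r ^+ (\sum_(s < t) nd s).
Proof.
move=> r0 wle wnd; elim=> [|t IH]; first by rewrite big_ord0 expr0 mulr1.
rewrite big_ord_recr /=; have [ndt|_] := boolP (nd t); last first.
  by rewrite addn0; exact: le_trans IH.
rewrite addn1 exprS mulrCA; apply: le_trans (wnd _ ndt) _.
by rewrite ler_wpM2l.
Qed.

(* A drop step brings no gap bound of its own, so the last non-drop step must do
   with one power of [r] less than step [T] has accumulated: the missing factor
   is the one gained at step 0. *)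
Lemma best_gap_bound (R : realType) (C nu r : R) (w g : nat -> R) (nd : nat -> bool) :
  0 <= C -> 0 <= r <= 1 -> (forall t, 0 <= w t) ->
  (forall t, w t.+1 <= w t) ->
  (forall t, nd t -> w t.+1 <= r * w t /\ gap_le C nu (g t) (w t)) ->
  nd 0%N -> w 1%N <= r ^+ 2 * w 0%N -> gap_le C nu (g 0%N) (r * w 0%N) ->
  forall T, exists2 t, (t <= T)%N &
    gap_le C nu (g t) (w 0%N * r ^+ (\sum_(s < T) nd s)).
Proof.
move=> C0 /andP[r0 r1] w0 wle wnd nd0 w1 g0 T.
pose k t := (\sum_(s < t) nd s)%N.
have k1 : k 1%N = 1%N by rewrite /k big_ord1 nd0.
have kS t : k t.+1 = (k t + nd t)%N by rewrite /k big_ord_recr.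
(* The double contraction at step 0 keeps the merit one power ahead of the count. *)
have extra t : w t.+1 <= w 0%N * r ^+ (k t.+1).+1.
  elim: t => [|t IH]; first by rewrite k1 mulrC.
  rewrite kS; have [ndt|_] := boolP (nd t.+1); last by rewrite addn0; exact: le_trans IH.
  by rewrite addn1 exprS mulrCA; apply: le_trans (wnd _ ndt).1 _; rewrite ler_wpM2l.
(* The induction runs on the stronger exponent that also counts step [T] itself. *)
suff [t tT gt] : exists2 t, (t <= T)%N & gap_le C nu (g t) (w 0%N * r ^+ k T.+1).
  exists t => //; apply: gap_le_trans gt => //; rewrite ler_wpM2l // kS exprD.
  by rewrite ler_piMr ?exprn_ge0 // exprn_ile1.
elim: T => [|T [t tT gt]]; first by exists 0%N; rewrite // k1 expr1 mulrC.
have [ndt|nnd] := boolP (nd T.+1); last first.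
  by exists t; rewrite ?(leqW tT) // kS (negbTE nnd) addn0.
exists T.+1 => //; apply: gap_le_trans (wnd _ ndt).2 => //.
by rewrite kS ndt addn1; exact: extra.
Qed.

(** * Weights, active sets and the maximal away step *)

(** Unlike in [conv_atoms] the weights are explicit, because the active set depends on them and not
    on the point alone. *)
Definition conv_rep (R : realType) (k p : nat) (a : 'I_p -> 'rV[R]_k) (w : 'I_p -> R)
  (u : 'rV[R]_k) : Prop :=
  [/\ forall i, 0 <= w i, \sum_i w i = 1 & u = \sum_i w i *: a i].

Lemma conv_rep_atoms (R : realType) (k p : nat) (a : 'I_p -> 'rV[R]_k) (w : 'I_p -> R)
  (u : 'rV[R]_k) : conv_rep a w u -> conv_atoms a u.
Proof. by case=> w0 w1 uw; exists w. Qed.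

Lemma conv_rep_le1 (R : realType) (k p : nat) (a : 'I_p -> 'rV[R]_k) (w : 'I_p -> R)
  (u : 'rV[R]_k) i : conv_rep a w u -> w i <= 1.
Proof.
case=> w0 <- _; rewrite (bigD1 i) //= lerDl; apply: sumr_ge0 => j _; exact: w0.
Qed.

Lemma conv_rep_one (R : realType) (k p : nat) (a : 'I_p -> 'rV[R]_k) (w : 'I_p -> R)
  (u : 'rV[R]_k) i : conv_rep a w u -> w i = 1 -> u = a i.
Proof.
case=> w0 w1 -> wi; rewrite (bigD1 i) //= wi scale1r big1 ?addr0 // => j ji.
suff -> : w j = 0 by rewrite scale0r.
move: w1; rewrite (bigD1 i) //= wi => /(canRL (addKr _)); rewrite addNr => /psumr_eq0P.
by apply => // l _; exact: w0.
Qed.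

Lemma sum_if_eq (V : nmodType) (p : nat) (f : 'I_p) (c : V) :
  \sum_i (if i == f then c else 0) = c.
Proof. by rewrite -big_mkcond big_pred1_eq. Qed.

Lemma sum_if_scale (R : realType) (k p : nat) (a : 'I_p -> 'rV[R]_k) (f : 'I_p) (c : R) :
  \sum_i (if i == f then c else 0) *: a i = c *: a f.
Proof.
rewrite (bigD1 f) //= eqxx big1 ?addr0 // => i /negPf ->.
by rewrite scale0r.
Qed.

Lemma conv_rep_fw (R : realType) (k p : nat) (a : 'I_p -> 'rV[R]_k) (w w' : 'I_p -> R)
  (u : 'rV[R]_k) (f : 'I_p) (g : R) : conv_rep a w u -> 0 <= g <= 1 ->
  (forall i, w' i = (1 - g) * w i + (if i == f then g else 0)) ->
  conv_rep a w' (u + g *: (a f - u)).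
Proof.
move=> [w0 w1 uw] /andP[g0 g1] w'E; split.
- move=> i; rewrite w'E addr_ge0 ?mulr_ge0 ?subr_ge0 //; by case: ifP.
- under eq_bigr do rewrite w'E.
  by rewrite big_split /= -mulr_sumr w1 sum_if_eq; lra.
- under eq_bigr do rewrite w'E scalerDl -scalerA.
  by rewrite big_split /= -scaler_sumr -uw sum_if_scale combineE.
Qed.

(** The bound on [g] is [g <= w v / (1 - w v)] cleared of its denominator, so it keeps its meaning
    when [w v = 1]. *)
Lemma conv_rep_away (R : realType) (k p : nat) (a : 'I_p -> 'rV[R]_k) (w w' : 'I_p -> R)
  (u : 'rV[R]_k) (v : 'I_p) (g : R) : conv_rep a w u -> 0 <= g -> g * (1 - w v) <= w v ->
  (forall i, w' i = (1 + g) * w i - (if i == v then g else 0)) ->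
  conv_rep a w' (u + g *: (u - a v)).
Proof.
move=> [w0 w1 uw] g0 gv w'E; split.
- move=> i; rewrite w'E; have [->|_] := eqVneq i v; first by lra.
  by rewrite subr0 mulr_ge0 // addr_ge0.
- under eq_bigr do rewrite w'E.
  by rewrite sumrB -mulr_sumr w1 sum_if_eq; lra.
- under eq_bigr do rewrite w'E scalerBl -scalerA.
  rewrite sumrB -scaler_sumr -uw sum_if_scale.
  by rewrite scalerDl scale1r scalerBr addrA.
Qed.

Definition nactive (R : realType) (p : nat) (w : 'I_p -> R) : nat :=
  #|[set i | 0 < w i]%SET|.

Lemma nactive_gt0 (R : realType) (k p : nat) (a : 'I_p -> 'rV[R]_k) (w : 'I_p -> R)
  (u : 'rV[R]_k) : conv_rep a w u -> (0 < nactive w)%N.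
Proof.
case=> w0 w1 uw; apply/card_gt0P.
exact: (support_rep_nonempty (support_rep_supp w0 w1 uw)).
Qed.

Lemma nactive_fw (R : realType) (k p : nat) (a : 'I_p -> 'rV[R]_k) (w w' : 'I_p -> R)
  (u : 'rV[R]_k) (f : 'I_p) (g : R) : conv_rep a w u ->
  (forall i, w' i = (1 - g) * w i + (if i == f then g else 0)) ->
  (nactive w' <= (nactive w).+1)%N.
Proof.
move=> [w0 _ _] w'E; apply: (@leq_trans #|f |: [set i | 0 < w i]%SET|); last first.
  by rewrite cardsU1 -addn1 addnC leq_add2l; case: (_ \notin _).
apply: subset_leq_card; apply/fintype.subsetP => i; rewrite !inE w'E.
case: eqVneq => //= _; rewrite addr0 => h; rewrite lt0r w0 andbT.
by apply: contraL h => /eqP ->; rewrite mulr0 ltxx.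
Qed.

(** An away step gives no weight to an inactive atom. The new weight of [v] is
    [w v - g * (1 - w v)], so equality in the feasibility bound removes [v]. *)
Lemma nactive_away (R : realType) (k p : nat) (a : 'I_p -> 'rV[R]_k) (w w' : 'I_p -> R)
  (u : 'rV[R]_k) (v : 'I_p) (g : R) : conv_rep a w u -> 0 <= g ->
  (forall i, w' i = (1 + g) * w i - (if i == v then g else 0)) ->
  (nactive w' <= nactive w)%N /\
  (0 < w v -> g * (1 - w v) = w v -> (nactive w' < nactive w)%N).
Proof.
move=> [w0 _ _] g0 w'E.
have sub : [set i | 0 < w' i]%SET \subset [set i | 0 < w i]%SET.
  apply/fintype.subsetP => i; rewrite !inE w'E => h; rewrite lt0r w0 andbT.
  apply: contraL h => /eqP ->; rewrite mulr0 sub0r oppr_gt0 -leNgt.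
  by case: ifP.
split; first exact: subset_leq_card.
move=> wv gv; apply: proper_card; rewrite properE sub /=.
apply/negP => /fintype.subsetP /(_ v); rewrite !inE => /(_ wv); rewrite w'E eqxx.
by rewrite (_ : _ - g = 0) ?ltxx //; lra.
Qed.

Lemma away_gmax_ge0 (R : realType) (al be : R) : 0 < al <= 1 -> 0 < be <= 1 ->
  0 <= away_gmax al be.
Proof.
move=> /andP[a0 a1] /andP[b0 b1].
have A : 0 <= al / (1 - al) by rewrite divr_ge0 ?subr_ge0 // ltW.
have B : 0 <= be / (1 - be) by rewrite divr_ge0 ?subr_ge0 // ltW.
by rewrite /away_gmax; case: ifP => _ //; case: ifP => _ //; rewrite le_min A B.
Qed.

Lemma away_gmax_feasible (R : realType) (al be g : R) : 0 < al <= 1 -> 0 < be <= 1 ->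
  0 <= g <= away_gmax al be -> g * (1 - al) <= al /\ g * (1 - be) <= be.
Proof.
move=> /andP[a0 a1] /andP[b0 b1] /andP[g0]; rewrite /away_gmax.
have [->|an] := eqVneq al 1.
  move=> gb; split; first by lra.
  have [->|bn] := eqVneq be 1; first by lra.
  by rewrite -ler_pdivlMr // subr_gt0 lt_neqAle bn.
have [->|bn] := eqVneq be 1; last first.
  by rewrite le_min => /andP[ga gb]; split; rewrite -ler_pdivlMr // subr_gt0 lt_neqAle ?an ?bn.
move=> ga; split; last by lra.
by rewrite -ler_pdivlMr // subr_gt0 lt_neqAle an.
Qed.

(** A maximal away step empties the away atom of at least one block. With both weights 1 the
    quotient is [1 / 0 = 0] and no atom leaves, hence the exclusion. *)
Lemma away_gmax_tight (R : realType) (al be : R) :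
  ~ (al = 1 /\ be = 1) ->
  away_gmax al be * (1 - al) = al \/ away_gmax al be * (1 - be) = be.
Proof.
move=> n1; rewrite /away_gmax.
have [a1|an] := eqVneq al 1.
  right; rewrite mulfVK // subr_eq0 eq_sym; apply: contra_notN n1 => /eqP.
  by [].
have [b1|bn] := eqVneq be 1.
  by left; rewrite mulfVK // subr_eq0 eq_sym.
case: leP => _; [left|right]; by rewrite mulfVK // subr_eq0 eq_sym.
Qed.

(** * Linear rate of SP-AFW *)

(** Freezing one block at its selected atom splits each joint oracle condition into one per block;
    for the away vertex this uses that both selected weights are positive. *)
Lemma afw_gap_bounds (R : realType) (n m p q : nat) (a : 'I_p -> 'rV[R]_n)
  (b : 'I_q -> 'rV[R]_m) (L : 'rV[R]_n -> 'rV[R]_m -> R) (xs : 'rV[R]_n) (ys : 'rV[R]_m)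
  (mu : R) (x : 'rV[R]_n) (y : 'rV[R]_m) (wx : 'I_p -> R) (wy : 'I_q -> R)
  (fx vx : 'I_p) (fy vy : 'I_q) :
  scc_problem (conv_atoms a) (conv_atoms b) L xs ys -> 0 < mu ->
  (forall r, muA_set_X a (conv_atoms b) L r -> mu <= r) ->
  (forall r, muA_set_X b (conv_atoms a) (flip L) r -> mu <= r) ->
  conv_rep a wx x -> conv_rep b wy y ->
  (forall x' y', conv_atoms a x' -> conv_atoms b y' ->
     rdot L x y (a fx) (b fy) <= rdot L x y x' y') ->
  0 < wx vx -> 0 < wy vy ->
  (forall i j, 0 < wx i -> 0 < wy j ->
     rdot L x y (a i) (b j) <= rdot L x y (a vx) (b vy)) ->
  [/\ wgap L xs ys x y <= gap_fw L x y (a fx) (b fy),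
      0 <= gap_away L x y (a vx) (b vy) &
      wgap L xs ys x y <= gap_pfw L x y (a fx) (b fy) (a vx) (b vy) ^+ 2 / (2 * mu)].
Proof.
move=> H mu0 muX muY rx ry fP vx0 vy0 vP.
have Xx := conv_rep_atoms rx; have Yy := conv_rep_atoms ry.
have wg := wgap_le_gap_fw H Xx Yy fP.
have fPx x' : conv_atoms a x' -> dotv (a fx) (gradx L x y) <= dotv x' (gradx L x y).
  by move=> Xx'; have := fP _ _ Xx' (conv_atom b fy); rewrite /rdot lerD2r.
have fPy y' : conv_atoms b y' ->
    dotv (b fy) (gradx (flip L) y x) <= dotv y' (gradx (flip L) y x).
  move=> Yy'; have := fP _ _ (conv_atom a fx) Yy'.
  by rewrite (gradx_flip H Xx Yy) !dotvNr /rdot lerD2l.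
have vPx i : 0 < wx i -> dotv (a i) (gradx L x y) <= dotv (a vx) (gradx L x y).
  by move=> wi; have := vP _ _ wi vy0; rewrite /rdot lerD2r.
have vPy j : 0 < wy j ->
    dotv (b j) (gradx (flip L) y x) <= dotv (b vy) (gradx (flip L) y x).
  move=> wj; have := vP _ _ vx0 wj.
  by rewrite (gradx_flip H Xx Yy) !dotvNr /rdot lerD2l.
have [wx0 wx1 xE] := rx; have [wy0 wy1 yE] := ry.
have xv : dotv x (gradx L x y) <= dotv (a vx) (gradx L x y).
  rewrite dotvC {2}xE conv_atoms_dot_le // => i wi.
  by rewrite dotvC vPx.
have yv : dotv y (gradx (flip L) y x) <= dotv (b vy) (gradx (flip L) y x).
  rewrite dotvC {2}yE conv_atoms_dot_le // => i wi.
  by rewrite dotvC vPy.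
have px := geometric_progress H mu0 muX wx0 wx1 xE Yy vx0 vPx fPx.
have py := geometric_progress (scc_flip H) mu0 muY wy0 wy1 yE Xx vy0 vPy fPy.
have gx0 : 0 <= dotv (a vx - a fx) (gradx L x y).
  by rewrite dotvBl subr_ge0 (le_trans _ xv) // fPx.
have gy0 : 0 <= dotv (b vy - b fy) (gradx (flip L) y x).
  by rewrite dotvBl subr_ge0 (le_trans _ yv) // fPy.
have gE : dotv (a vx - a fx) (gradx L x y) + dotv (b vy - b fy) (gradx (flip L) y x) =
    gap_pfw L x y (a fx) (b fy) (a vx) (b vy).
  rewrite /gap_pfw /gap_fw /gap_away /rdot (gradx_flip H Xx Yy) dotvNr !dotvBl; lra.
split=> //.
  move: yv; rewrite (gradx_flip H Xx Yy) !dotvNr /gap_away /rdot; lra.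
have := sqrD_le gx0 gy0 mu0; rewrite gE.
by move: px py; rewrite /wgap /flip; lra.
Qed.

Lemma mean_le_max (R : realType) (u v : R) : (u + v) / 2 <= Num.max u v.
Proof.
by rewrite le_max; apply/orP; case: (lerP u v) => h; [right|left]; lra.
Qed.

(** The descent is stated with the larger of the two gaps, not with half of their sum, because step
    0 needs the sharper form. *)
Lemma afw_step (R : realType) (n m p q : nat) (a : 'I_p -> 'rV[R]_n)
  (b : 'I_q -> 'rV[R]_m) (L : 'rV[R]_n -> 'rV[R]_m -> R) (xs : 'rV[R]_n) (ys : 'rV[R]_m)
  (nu C mu : R) (x : nat -> 'rV[R]_n) (y : nat -> 'rV[R]_m)
  (ax : nat -> 'I_p -> R) (ay : nat -> 'I_q -> R)
  (fx vx : nat -> 'I_p) (fy vy : nat -> 'I_q) (t : nat) :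
  bounded_problem (conv_atoms a) (conv_atoms b) L xs ys -> 0 < C -> 0 < nu -> 0 < mu ->
  C = curvature (conv_atoms a) (conv_atoms b) L ->
  (forall r, muA_set_X a (conv_atoms b) L r -> mu <= r) ->
  (forall r, muA_set_X b (conv_atoms a) (flip L) r -> mu <= r) ->
  sp_afw_run a b L nu C x y ax ay fx vx fy vy ->
  conv_rep a (ax t) (x t) -> conv_rep b (ay t) (y t) ->
  let w s := wgap L xs ys (x s) (y s) in
  let gf := gap_fw L (x t) (y t) (a (fx t)) (b (fy t)) in
  let ga := gap_away L (x t) (y t) (a (vx t)) (b (vy t)) in
  let gam := afw_gamma L nu C (x t) (y t) (a (fx t)) (b (fy t)) (a (vx t)) (b (vy t))
    (ax t (vx t)) (ay t (vy t)) in
  let drop := afw_drop L nu C (x t) (y t) (a (fx t)) (b (fy t)) (a (vx t)) (b (vy t))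
    (ax t (vx t)) (ay t (vy t)) in
  let M := M_L (conv_atoms a) (conv_atoms b) L xs ys in
  [/\ conv_rep a (ax t.+1) (x t.+1) /\ conv_rep b (ay t.+1) (y t.+1),
      [/\ w t <= gf, 0 <= ga & w t <= (gf + ga) ^+ 2 / (2 * mu)],
      0 <= gam <= nu / (2 * C) * (gf + ga) /\
        (~~ drop -> gam = nu / (2 * C) * (gf + ga) \/
          (gam = 1 /\ 1 <= nu / (2 * C) * (gf + ga))),
      w t.+1 <= w t - gam * Num.max gf ga + gam * (M * Num.sqrt (2 * w t)) + gam ^+ 2 * C &
      (nactive (ax t.+1) + nactive (ay t.+1) + drop <=
        nactive (ax t) + nactive (ay t) + 2 * ~~ drop)%N].
Proof.
move=> B C0 nu0 mu0 CE muX muY [_ run] rx ry w gf ga gam drop M.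
have [H _ [ucX ucY] [uMX uMY]] := B.
have [_ _ _ _ sp] := H.
have [fP [vx0 [vy0 [vP upd]]]] := run t.
have Xx := conv_rep_atoms rx; have Yy := conv_rep_atoms ry.
have [wgf ga0 wg2] := afw_gap_bounds H mu0 muX muY rx ry fP vx0 vy0 vP.
have w0 : 0 <= w t by exact: wgap_ge0 sp Xx Yy.
have gf0 : 0 <= gf by exact: le_trans w0 wgf.
have al01 : 0 < ax t (vx t) <= 1 by rewrite vx0 (conv_rep_le1 _ rx).
have be01 : 0 < ay t (vy t) <= 1 by rewrite vy0 (conv_rep_le1 _ ry).
have q0 : 0 <= nu / (2 * C) * (gf + ga).
  by apply: mulr_ge0; [rewrite divr_ge0 ?mulr_ge0 // ltW | exact: addr_ge0].
have : gam = if afw_is_fw L (x t) (y t) (a (fx t)) (b (fy t)) (a (vx t)) (b (vy t))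
    then Num.min 1 (nu / (2 * C) * (gf + ga))
    else Num.min (away_gmax (ax t (vx t)) (ay t (vy t))) (nu / (2 * C) * (gf + ga)) by [].
move: upd; rewrite /drop /afw_drop /= -/gam; move: gam => gam {drop}.
case: ifP => isfw upd gamE; move: upd.
  move: (isfw); rewrite /afw_is_fw -/gf -/ga => gaf.
  move=> [xE [yE [axE ayE]]].
  have gam01 : 0 <= gam <= 1 by rewrite gamE ge_min lexx le_min ler01 q0.
  have /andP[gam0 _] := gam01.
  have rx' := conv_rep_fw rx gam01 axE; have ry' := conv_rep_fw ry gam01 ayE.
  split=> //.
  - by rewrite xE yE.
  - split; first by rewrite gam0 gamE ge_min lexx orbT.
    by move=> _; rewrite gamE; exact: step_size_clipped.
  - have des := wgap_descent H ucX ucY uMX uMY Xx (conv_atom a (fx t)) Xx Yy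
      (conv_atom b (fy t)) Yy gam0 (conv_rep_atoms rx') (conv_rep_atoms ry').
    rewrite rdot_fw_direction -CE -/gf -/(w t) in des.
    by rewrite /w xE yE; apply: le_trans des _; rewrite max_l // mulrN.
  - have := nactive_fw rx axE; have := nactive_fw ry ayE.
    by rewrite /= addn0 muln1; move: (nactive (ax t)) (nactive (ay t)) (nactive (ax t.+1)) (nactive (ay t.+1)); clear; lia.
move: (isfw); rewrite /afw_is_fw -/gf -/ga => /negbT; rewrite -ltNge => gaf.
move=> [xE [yE [axE ayE]]].
have gmax0 := away_gmax_ge0 al01 be01.
have gam0 : 0 <= gam by rewrite gamE le_min gmax0 q0.
have gamM : 0 <= gam <= away_gmax (ax t (vx t)) (ay t (vy t)).
  by rewrite gam0 gamE ge_min lexx.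
have [feasx feasy] := away_gmax_feasible al01 be01 gamM.
have rx' := conv_rep_away rx gam0 feasx axE; have ry' := conv_rep_away ry gam0 feasy ayE.
have [nx nxd] := nactive_away rx gam0 axE; have [ny nyd] := nactive_away ry gam0 ayE.
split=> //.
- by rewrite xE yE.
- split; first by rewrite gam0 gamE ge_min lexx orbT.
  move=> /= ne; left; rewrite gamE; have [//|[e _]] := step_size_clipped
    (away_gmax (ax t (vx t)) (ay t (vy t))) (nu / (2 * C) * (gf + ga)).
  by move: ne; rewrite gamE e eqxx.
- have des := wgap_descent H ucX ucY uMX uMY Xx Xx (conv_atom a (vx t)) Yy Yy
    (conv_atom b (vy t)) gam0 (conv_rep_atoms rx') (conv_rep_atoms ry').
  rewrite rdot_away_direction -CE -/ga -/(w t) in des.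
  by rewrite /w xE yE; apply: le_trans des _; rewrite max_r ?(ltW gaf) // mulrN.
- case: eqP => [e|_] /=; last first.
    by move: nx ny; move: (nactive (ax t)) (nactive (ay t)) (nactive (ax t.+1)) (nactive (ay t.+1)); clear; lia.
  (* If both weights were 1, the iterate would be its own away vertex and the away gap would be 0,
     although an away step requires it to exceed the nonnegative Frank-Wolfe gap. *)
  have n1 : ~ (ax t (vx t) = 1 /\ ay t (vy t) = 1).
    move=> [al1 be1]; have ex := conv_rep_one rx al1; have ey := conv_rep_one ry be1.
    by move: gaf; rewrite /ga /gap_away -ex -ey subrr ltNge gf0.
  have := away_gmax_tight n1; rewrite -e => -[/(nxd vx0)|/(nyd vy0)];
    move: nx ny; move: (nactive (ax t)) (nactive (ay t)) (nactive (ax t.+1)) (nactive (ay t.+1)); clear; lia.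
Qed.

Lemma sp_afw_linear_rate (R : realType) (n m p q : nat) (a : 'I_p -> 'rV[R]_n)
  (b : 'I_q -> 'rV[R]_m) (L : 'rV[R]_n -> 'rV[R]_m -> R) (xs : 'rV[R]_n) (ys : 'rV[R]_m)
  (nu C mu : R) (x : nat -> 'rV[R]_n) (y : nat -> 'rV[R]_m)
  (ax : nat -> 'I_p -> R) (ay : nat -> 'I_q -> R)
  (fx vx : nat -> 'I_p) (fy vy : nat -> 'I_q) :
  bounded_problem (conv_atoms a) (conv_atoms b) L xs ys ->
  C = curvature (conv_atoms a) (conv_atoms b) L -> mu = mu_A a b L -> 0 < mu ->
  nu = 2^-1 - M_L (conv_atoms a) (conv_atoms b) L xs ys / Num.sqrt mu -> 0 < nu ->
  sp_afw_run a b L nu C x y ax ay fx vx fy vy ->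
  let w t := wgap L xs ys (x t) (y t) in
  let g t := gap_pfw L (x t) (y t) (a (fx t)) (b (fy t)) (a (vx t)) (b (vy t)) in
  let nd t := ~~ afw_drop L nu C (x t) (y t) (a (fx t)) (b (fy t)) (a (vx t)) (b (vy t))
    (ax t (vx t)) (ay t (vy t)) in
  let rho := nu ^+ 2 * mu / (2 * C) in
  [/\ 0 < C, 0 <= rho <= 2^-1,
      forall t, [/\ conv_atoms a (x t) /\ conv_atoms b (y t), 0 <= w t, 0 <= g t,
        w t.+1 <= w t &
        nd t -> w t.+1 <= (1 - rho) * w t /\ gap_le C nu (g t) (w t)],
      [/\ nd 0%N, w 1%N <= (1 - rho) ^+ 2 * w 0%N & gap_le C nu (g 0%N) ((1 - rho) * w 0%N)] &
      forall t, (t <= 3 * \sum_(s < t) nd s)%N].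
Proof.
move=> B CE muE mu0 nuE nu0 run w g nd rho.
have [H _ _ [uMX uMY]] := B; have HF := scc_flip H.
have [_ _ _ _ sp] := H.
have [mX0 mY0] : 0 < inf (muA_set_X a (conv_atoms b) L) /\
    0 < inf (muA_set_Y (conv_atoms a) b L).
  by move: mu0; rewrite muE /mu_A lt_min => /andP.
have muX r : muA_set_X a (conv_atoms b) L r -> mu <= r.
  by move=> /(inf_le_mem mX0); apply: le_trans; rewrite muE /mu_A ge_min lexx.
have muY r : muA_set_X b (conv_atoms a) (flip L) r -> mu <= r.
  rewrite (muA_set_flip H) => /(inf_le_mem mY0); apply: le_trans.
  by rewrite muE /mu_A ge_min lexx orbT.
have muC : mu <= C.
  have [qx [Qx Cx]] := muA_meets_curv (inf_gt0_nonempty mX0).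
  move/inf_gt0_nonempty: mY0; rewrite -(muA_set_flip H) => /muA_meets_curv[qy [Qy Cy]].
  by rewrite CE; exact: (le_curvature B (muX _ Qx) Cx (muY _ Qy) Cy).
have C0 : 0 < C by exact: lt_le_trans muC.
have M0 : 0 <= M_L (conv_atoms a) (conv_atoms b) L xs ys by exact: M_L_ge0.
have nu1 : nu <= 1 by apply: (@le_trans _ _ 2^-1); [rewrite nuE nu_le | lra].
have /andP[rho0 rho1] := rho_le C0 mu0 muC nu0 nu1.
have step t := afw_step (t := t) B C0 nu0 mu0 CE muX muY run.
have [[i0 [j0 [x0 [y0 [ax0 ay0]]]]] runt] := run.
have reps t : conv_rep a (ax t) (x t) /\ conv_rep b (ay t) (y t).
  elim: t => [|t [rx ry]]; last by have [] := step t rx ry.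
  split; split.
  - by move=> i; rewrite ax0; case: ifP.
  - by under eq_bigr do rewrite ax0; rewrite sum_if_eq.
  - by under eq_bigr do rewrite ax0; rewrite sum_if_scale scale1r.
  - by move=> i; rewrite ay0; case: ifP.
  - by under eq_bigr do rewrite ay0; rewrite sum_if_eq.
  - by under eq_bigr do rewrite ay0; rewrite sum_if_scale scale1r.
have wge0 t : 0 <= w t.
  by have [rx ry] := reps t; apply: (wgap_ge0 sp (conv_rep_atoms rx) (conv_rep_atoms ry)).
split=> //; first by rewrite (ltW rho0) /= /rho; lra.
- move=> t; have [rx ry] := reps t.
  have [_ [wgf ga0 wg2] [/andP[gam0 gamle] gamE] des _] := step t rx ry.
  have gf0 := le_trans (wge0 t) wgf.
  have g0 : 0 <= g t by rewrite /g /gap_pfw addr_ge0.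
  have wg : w t <= g t by rewrite /g /gap_pfw -[leLHS]addr0 lerD.
  have bil := ler_wpM2l gam0 (bilinearity_term_le mu0 M0 g0 wg2).
  rewrite -/(w t) -/(w t.+1) in des bil.
  (* The larger gap is at least the mean: this is the 1/2 in [nu]. *)
  have half : g t / 2 <= Num.max (gap_fw L (x t) (y t) (a (fx t)) (b (fy t)))
      (gap_away L (x t) (y t) (a (vx t)) (b (vy t))).
    exact: mean_le_max.
  have {}half := ler_wpM2l gam0 half.
  move: gamle gamE; rewrite -/(g t) => gamle gamE.
  set gam := afw_gamma _ _ _ _ _ _ _ _ _ _ _ in gam0 gamle gamE des bil half.
  have des' : w t.+1 <= w t - nu * gam * g t + gam ^+ 2 * C.
    by apply: le_trans des _; rewrite nuE; lra.
  split=> //.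
  - by split; [exact: conv_rep_atoms rx | exact: conv_rep_atoms ry].
  - by apply: (unconstrained_step_le C0 gam0 gamle des'); rewrite mulr_ge0 // ltW.
  move=> ndt.
  exact: (non_drop_step C0 mu0 muC nu0 nu1 (wge0 t) (wge0 t.+1) wg wg2 (gamE ndt) des').
- have [rx ry] := reps 0%N.
  have [_ [wgf ga0 wg2] [/andP[gam0 gamle] gamE] des _] := step 0%N rx ry.
  have gf0 := le_trans (wge0 0%N) wgf.
  have [_ [vx0 [vy0 _]]] := runt 0%N.
  have vxE : vx 0%N = i0 by apply/eqP; move: vx0; rewrite ax0; case: eqP; rewrite ?ltxx.
  have vyE : vy 0%N = j0 by apply/eqP; move: vy0; rewrite ay0; case: eqP; rewrite ?ltxx.
  (* The only active atoms are the initial ones, so the away vertex is the iterate and step 0 is a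
     Frank-Wolfe step. *)
  have gaE : gap_away L (x 0%N) (y 0%N) (a (vx 0%N)) (b (vy 0%N)) = 0.
    by rewrite /gap_away vxE vyE -x0 -y0 subrr.
  have nd0 : nd 0%N by rewrite /nd /afw_drop /afw_is_fw gaE gf0.
  move: gamE => /(_ nd0); move: des wg2 gamle; rewrite gaE addr0 max_l // => des wg2 gamle gamE.
  have gE : g 0%N = gap_fw L (x 0%N) (y 0%N) (a (fx 0%N)) (b (fy 0%N)).
    by rewrite /g /gap_pfw gaE addr0.
  rewrite -gE -/(w 0%N) -/(w 1%N) in des wg2 gamE wgf gf0.
  have bil := ler_wpM2l gam0 (bilinearity_term_le mu0 M0 gf0 wg2).
  set gam := afw_gamma _ _ _ _ _ _ _ _ _ _ _ in gam0 gamle gamE des bil.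
  (* Here the larger gap is all of [g], so the coefficient is [1 - M / sqrt mu], that is
     [nu + 1/2]. *)
  have des' : w 1%N <= w 0%N - (nu + 2^-1) * gam * g 0%N + gam ^+ 2 * C.
    by apply: le_trans des _; rewrite nuE; lra.
  by have [] := first_step C0 mu0 muC nu0 nu1 (wge0 0%N) (wge0 1%N) wgf wg2 gamE des'.
- have one (k : nat) (i1 : 'I_k) (c : 'I_k -> R) :
      (forall i, c i = if i == i1 then 1 else 0) -> nactive c = 1%N.
    move=> cE; rewrite /nactive -(cards1 i1); congr #|pred_of_set _|; apply/setP => i.
    by rewrite !inE cE; case: eqP; rewrite ?ltr01 ?ltxx.
  (* Per step the left side grows by at most 3 if the step is non-drop and not at all if it is a
     drop. The initial 2 is absorbed by the one atom that each block always keeps. *)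
  have pot t : (nactive (ax t) + nactive (ay t) + t <= 2 + 3 * \sum_(s < t) nd s)%N.
    elim: t => [|t IH]; first by rewrite (one _ _ _ ax0) (one _ _ _ ay0).
    have [rx ry] := reps t; have [_ _ _ _] := step t rx ry.
    rewrite big_ord_recr /= -[~~ _]/(nd t) -[X in (_ + nat_of_bool X <= _)%N]negbK -/(nd t).
    move: IH; case: (nd t) => /=; move: (\sum_(s < t) nd s)%N;
      move: (nactive (ax t)) (nactive (ay t)) (nactive (ax t.+1)) (nactive (ay t.+1)); clear; lia.
  move=> t; have [rx ry] := reps t; move: (pot t) (nactive_gt0 rx) (nactive_gt0 ry).
  by move: (nactive (ax t)) (nactive (ay t)) (\sum_(s < t) nd s)%N; clear; lia.
Qed.

(** * Assembly of the two cases *)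

Theorem theorem24 (R : realType) (n m : nat)
  (X : set 'rV[R]_n) (Y : set 'rV[R]_m) (L : 'rV[R]_n -> 'rV[R]_m -> R)
  (xs : 'rV[R]_n) (ys : 'rV[R]_m) :
  X !=set0 -> convex_set X -> compact X ->
  Y !=set0 -> convex_set Y -> compact Y ->
  (forall x y, X x -> Y y -> differentiable (fun z : 'rV[R]_n * 'rV[R]_m => L z.1 z.2) (x, y)) ->
  unif_strongly_convex_concave X Y L ->
  saddle_point X Y L xs ys ->
  (* finite curvature constant C_L *)
  has_ubound (curv_set_X X Y L) -> has_ubound (curv_set_Y X Y L) ->
  (* finite bilinearity coefficient M_L (so that nu is a real number) *)
  has_ubound (M_set_XY X Y L xs ys) -> has_ubound (M_set_YX X Y L xs ys) ->
  let C := curvature X Y L in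
  let M := M_L X Y L xs ys in
  let P := P_L X Y L xs ys in
  (* case (I): SP-FW *)
  (rel_interior X xs -> rel_interior Y ys ->
   let mu := mu_int X Y L xs ys in
   0 < mu ->
   let nu := 1 - M / Num.sqrt mu in
   0 < nu ->
   let rho := nu ^+ 2 * mu / (2 * C) in
   forall (x : nat -> 'rV[R]_n) (y : nat -> 'rV[R]_m)
          (sx : nat -> 'rV[R]_n) (sy : nat -> 'rV[R]_m),
   sp_fw_run X Y L nu C x y sx sy ->
   let w0 := wgap L xs ys (x 0%N) (y 0%N) in
   let g := fun t => gap_fw L (x t) (y t) (sx t) (sy t) in
   let k := fun t : nat => t in
   ((has_ubound (P_set_X X Y L xs ys) -> has_ubound (P_set_Y X Y L xs ys) ->
     forall t, hgap X Y L (x t) (y t) <=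
               P * Num.sqrt (2 * w0) * (1 - rho) `^ ((k t)%:R / 2)) /\
    (forall T : nat, exists2 t : nat, (t <= T)%N &
       g t <= 2 * Num.max (Num.sqrt C) (Num.sqrt w0 * (1 - rho) `^ ((k T)%:R / 2)) / nu
              * (Num.sqrt w0 * (1 - rho) `^ ((k T)%:R / 2))))) /\
  (* case (P): SP-AFW *)
  (forall (p q : nat) (a : 'I_p -> 'rV[R]_n) (b : 'I_q -> 'rV[R]_m),
   injective a -> injective b ->
   X = conv_atoms a -> Y = conv_atoms b ->
   let mu := mu_A a b L in
   0 < mu ->
   let nu := 2^-1 - M / Num.sqrt mu in
   0 < nu ->
   let rho := nu ^+ 2 * mu / (2 * C) in
   forall (x : nat -> 'rV[R]_n) (y : nat -> 'rV[R]_m)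
          (ax : nat -> 'I_p -> R) (ay : nat -> 'I_q -> R)
          (fx vx : nat -> 'I_p) (fy vy : nat -> 'I_q),
   sp_afw_run a b L nu C x y ax ay fx vx fy vy ->
   let w0 := wgap L xs ys (x 0%N) (y 0%N) in
   let g := fun t => gap_pfw L (x t) (y t) (a (fx t)) (b (fy t)) (a (vx t)) (b (vy t)) in
   let k := afw_nondrop a b L nu C x y ax ay fx vx fy vy in
   ((has_ubound (P_set_X X Y L xs ys) -> has_ubound (P_set_Y X Y L xs ys) ->
     forall t, hgap X Y L (x t) (y t) <=
               P * Num.sqrt (2 * w0) * (1 - rho) `^ ((k t)%:R / 2)) /\
    (forall T : nat, exists2 t : nat, (t <= T)%N &
       g t <= 2 * Num.max (Num.sqrt C) (Num.sqrt w0 * (1 - rho) `^ ((k T)%:R / 2)) / nu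
              * (Num.sqrt w0 * (1 - rho) `^ ((k T)%:R / 2))) /\
    (forall t : nat, (t <= 3 * k t)%N))).
Proof.
move=> _ cvX cX _ cvY cY dL scc sp ucX ucY uMX uMY C M P.
have H : scc_problem X Y L xs ys.
  split=> // x y Xx Yy; split.
    exact: differentiable_fst_arg (dL _ _ Xx Yy).
  exact: differentiable_snd_arg (dL _ _ Xx Yy).
have B : bounded_problem X Y L xs ys by [].
split.
  move=> _ _ mu mu0 nu nu0 rho x y sx sy run w0 g k.
  have [C0 /andP[r0 r1] rate] := sp_fw_linear_rate B erefl erefl mu0 erefl nu0 run.
  have q0 : 0 <= 1 - rho by rewrite subr_ge0; apply: le_trans r1 _; lra.
  have w00 : 0 <= w0 by have [_] := rate 0%N.
  have wle t : wgap L xs ys (x t) (y t) <= w0 * (1 - rho) ^+ t.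
    elim: t => [|t IH]; first by rewrite expr0 mulr1.
    have [_ _ _ h _] := rate t; apply: le_trans h _.
    by rewrite (exprS _ t) (mulrCA w0); exact: ler_wpM2l.
  split.
    move=> uPX uPY t; have [[Xx Yy] _ _ _ _] := rate t.
    have := hgap_bound H cX cY uPX uPY Xx Yy (wle t).
    rewrite (mulrA 2) sqrt_geometric ?(mulrA (P_L _ _ _ _ _)) //.
    by rewrite mulr_ge0.
  move=> T; exists T => //; have [_ _ g0 _ hg] := rate T.
  rewrite -sqrt_geometric //; apply: gap_leP => //; rewrite ?(ltW C0) //.
    by rewrite mulr_ge0 ?exprn_ge0.
  by apply: gap_le_trans hg => //; exact: ltW.
move=> p q a b _ _ XE YE mu mu0 nu nu0 rho x y ax ay fx vx fy vy run w0 g k.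
rewrite XE YE in B.
have CE : C = curvature (conv_atoms a) (conv_atoms b) L by rewrite /C XE YE.
have nuE : nu = 2^-1 - M_L (conv_atoms a) (conv_atoms b) L xs ys / Num.sqrt mu.
  by rewrite /nu /M XE YE.
have [C0 /andP[r0 r1] rate [nd0 w1 g0] count] :=
  sp_afw_linear_rate B CE erefl mu0 nuE nu0 run.
pose nd s := ~~ afw_drop L nu C (x s) (y s) (a (fx s)) (b (fy s))
    (a (vx s)) (b (vy s)) (ax s (vx s)) (ay s (vy s)).
have kE t : k t = (\sum_(s < t) nd s)%N.
  by apply: eq_bigr => s _; rewrite /nd; case: (afw_drop _ _ _ _ _ _ _ _ _ _ _).
have q0 : 0 <= 1 - rho by rewrite subr_ge0; apply: le_trans r1 _; lra.
have w00 : 0 <= w0 by have [_] := rate 0%N.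
have wpos t : 0 <= wgap L xs ys (x t) (y t) by have [] := rate t.
have wdec t : wgap L xs ys (x t.+1) (y t.+1) <= wgap L xs ys (x t) (y t).
  by have [] := rate t.
split; last split.
- move=> uPX uPY t; have [[Xx Yy] _ _ _ _] := rate t.
  rewrite -XE in Xx; rewrite -YE in Yy.
  have wt : wgap L xs ys (x t) (y t) <= w0 * (1 - rho) ^+ k t.
    rewrite kE; apply: (@geometric_decay _ _ (fun t => wgap L xs ys (x t) (y t)) nd) => //.
    by move=> s nds; have [_ _ _ _ /(_ nds)[]] := rate s.
  have := hgap_bound H cX cY uPX uPY Xx Yy wt.
  rewrite (mulrA 2) sqrt_geometric ?(mulrA (P_L _ _ _ _ _)) //.
    by rewrite mulr_ge0.
- move=> T; have q01 : 0 <= 1 - rho <= 1 by rewrite q0 gerBl.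
  have [t tT gt] := @best_gap_bound _ C nu _ (fun t => wgap L xs ys (x t) (y t)) g nd
    (ltW C0) q01 wpos wdec
    (fun s => let: And5 _ _ _ _ h := rate s in h) nd0 w1 g0 T.
  exists t => //; rewrite -sqrt_geometric // kE; apply: gap_leP => //; rewrite ?(ltW C0) //.
    by have [] := rate t.
  by rewrite mulr_ge0 ?exprn_ge0.
- by move=> t; rewrite kE; exact: count.
Qed.
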